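(* Let $G$ be a finite group generated by pseudoreflections on $\mathbb{C}^n$, $d=|G|$, let $\Omega\subseteq\mathbb{C}^n$ be a bounded $G$-invariant domain, $\{\theta_i\}_{i=1}^n$ a homogeneous system of parameters associated to $G$, $\boldsymbol\theta=(\theta_1,\ldots,\theta_n)$, and let $\mathcal{H}\subseteq\mathcal{O}(\Omega)$ be an analytic Hilbert module over $\mathbb{C}[\boldsymbol z]$ with a $G$-invariant reproducing kernel. Then the Hilbert space $\widetilde{\mathcal{H}}=\Gamma\mathcal{H}$ is a reproducing kernel Hilbert space consisting of $\mathbb{C}^{|G|}$-valued holomorphic functions on $\boldsymbol\theta(\Omega)$.
   Context: A pseudoreflection on $\mathbb{C}^n$ is a linear map $\rho$ of finite order in $GL(n,\mathbb{C})$ such that $I_n-\rho$ has rank $1$. $\Omega$ is $G$-invariant if $\sigma(\Omega)=\Omega$ for all $\sigma\in G$. A homogeneous system of parameters associated to $G$ is a family $\{\theta_i\}_{i=1}^n$ of algebraically independent homogeneous $G$-invariant polynomials with $\mathbb{C}[\boldsymbol z]^G=\mathbb{C}[\theta_1,\ldots,\theta_n]$, where $\mathbb{C}[\boldsymbol z]^G$ is the ring of $G$-invariant polynomials in $\mathbb{C}[\boldsymbol z]=\mathbb{C}[z_1,\ldots,z_n]$. The set $\boldsymbol\theta(\Omega)$ is a domain. An analytic Hilbert module $\mathcal{H}\subseteq\mathcal{O}(\Omega)$ over $\mathbb{C}[\boldsymbol z]$ is a Hilbert space of holomorphic functions on $\Omega$ with a reproducing kernel $K$, on which multiplication by each polynomial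 is bounded, and which contains $\mathbb{C}[\boldsymbol z]$ as a dense subspace. $K$ is $G$-invariant if $K(\sigma\boldsymbol z,\sigma\boldsymbol w)=K(\boldsymbol z,\boldsymbol w)$ for all $\sigma\in G$, $\boldsymbol z,\boldsymbol w\in\Omega$. Definition of $\Gamma$ and $\widetilde{\mathcal H}$: let $p_1,\ldots,p_d$ be a basis of $\mathbb{C}[\boldsymbol z]$ as a free $\mathbb{C}[\boldsymbol z]^G$-module. Every $f\in\mathcal{O}(\Omega)$ can be written uniquely as $f=\sum_{k=1}^d p_k\,(\tilde f_k\circ\boldsymbol\theta)$ with $\tilde f_k$ holomorphic on $\boldsymbol\theta(\Omega)$ (analytic Chevalley-Shephard-Todd theorem). Define $\Gamma:\mathcal{H}\to\mathcal{O}(\boldsymbol\theta(\Omega))\otimes\mathbb{C}^d$ by $\Gamma f=\sum_{k=1}^d\tilde f_k\otimes\varepsilon_k$, with $\{\varepsilon_k\}$ the standard basis of $\mathbb{C}^d$. $\Gamma$ is linear and injective; $\widetilde{\mathcal H}:=\Gamma\mathcal{H}$ with inner product $\langle\Gamma f,\Gamma g\rangle_{\widetilde{\mathcal H}}:=\langle f,g\rangle_{\mathcal{H}}$. A reproducing kernel for a Hilbert space of $\mathbb{C}^d$-valued holomorphic functions on a domain $D$ is a function $\mathbb{K}:D\times D\to\mathcal{L}(\mathbb{C}^d)$, holomorphic in the first and anti-holomorphic in the second variable, such that $\mathbb{K}(\cdot,\boldsymbol v)\boldsymbol x$ lies in the space and $\langle\boldsymbol f,\mathbb{K}(\cdot,\boldsymbol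 v)\boldsymbol x\rangle=\langle\boldsymbol f(\boldsymbol v),\boldsymbol x\rangle_{\mathbb{C}^d}$ for all $\boldsymbol f$ in the space, $\boldsymbol v\in D$, $\boldsymbol x\in\mathbb{C}^d$. *)

(* Defs.v *)
From HB Require Import structures.
From mathcomp Require Import all_boot all_order all_algebra.
From mathcomp Require Import finmap.
From mathcomp Require Import all_classical all_reals all_analysis.
From mathcomp Require Import complex.
(* The notations of mpoly clash with those of MathComp-Analysis. *)
From mathcomp Require Import -(notations) mpoly.

Set Implicit Arguments.
Unset Strict Implicit.
Unset Printing Implicit Defensive.

Import Order.TTheory GRing.Theory Num.Theory.
Import numFieldNormedType.Exports.

Local Open Scope classical_set_scope.
Local Open Scope ring_scope.
Local Open Scope complex_scope.

Notation "{ 'mpoly' T [ n ] }" := (mpoly n T) : type_scope.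

Section HilbertFunctionSpaces.
Variable R : realType.
Local Notation C := R[i].

Section Hilbert.
Variable E : lmodType C.

Definition ip_norm (ip : E -> E -> C) (f : E) : C := sqrtC (ip f f).

(* [H], a subset of the ambient space [E], is a Hilbert space for [ip], which
   is only relevant on [H] and is linear in its first argument. *)
Record hilbert_space (H : set E) (ip : E -> E -> C) : Prop := HilbertSpace {
  hilbert0 : H 0;
  hilbertP : forall (a : C) f g, H f -> H g -> H (a *: f + g);
  hilbert_ipP : forall (a : C) f g h, H f -> H g -> H h ->
    ip (a *: f + g) h = a * ip f h + ip g h;
  hilbert_ipC : forall f g, H f -> H g -> ip g f = Num.conj (ip f g);
  hilbert_ip_ge0 : forall f, H f -> 0 <= ip f f;
  hilbert_ip_eq0 : forall f, H f -> ip f f = 0 -> f = 0;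
  hilbert_complete : forall u : nat -> E, (forall k, H (u k)) ->
    (forall e : C, 0 < e -> exists N, forall k l, (N <= k)%N -> (N <= l)%N ->
       ip_norm ip (u k - u l) < e) ->
    exists2 f, H f & forall e : C, 0 < e -> exists N, forall k, (N <= k)%N ->
      ip_norm ip (u k - f) < e
}.

End Hilbert.

Section Holomorphic.
Variables V W : normedModType C.

Definition domain (D : set V) : Prop := [/\ D !=set0, open D & connected D].

(* Functions on [D] are represented by their extension by 0 outside [D], so
   that equality on [D] is Leibniz equality.  Differentiability is over the
   field [C], i.e. it is complex differentiability. *)
Definition holo (D : set V) : set (V -> W) :=
  [set f | (forall z, D z -> differentiable f z) /\
           (forall z, ~ D z -> f z = 0)].

End Holomorphic.

Section ScalarKernel.
Variable V : normedModType C.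

Definition reproducing_kernel (D : set V) (H : set (V -> C^o))
    (ip : (V -> C^o) -> (V -> C^o) -> C) (K : V -> V -> C^o) : Prop :=
  forall w, D w ->
    H (K ^~ w) /\ forall f, H f -> ip f (K ^~ w) = f w.

End ScalarKernel.

Section VectorKernel.
Variables (V : normedModType C) (d : nat).

Definition cdot (x y : 'cV[C]_d) : C := \sum_k x k 0 * Num.conj (y k 0).

(* Operators on C^d are identified with their matrices in the standard basis.
   In line with [holo], [K] vanishes outside [D * D]. *)
Record vreproducing_kernel (D : set V) (H : set (V -> 'cV[C]_d))
    (ip : (V -> 'cV[C]_d) -> (V -> 'cV[C]_d) -> C)
    (K : V -> V -> 'M[C]_d) : Prop := VReproducingKernel {
  vrk_holo : forall v, D v -> @holo V 'M[C]_d D (K ^~ v);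
  vrk_antiholo : forall u, D u ->
    @holo V 'M[C]_d D (fun v => map_mx Num.conj (K u v));
  vrk_mem : forall v x, D v -> H (fun u => K u v *m x);
  vrk_reproducing : forall f v x, H f -> D v ->
    ip f (fun u => K u v *m x) = cdot (f v) x
}.

Definition vrkhs (D : set V) (H : set (V -> 'cV[C]_d))
    (ip : (V -> 'cV[C]_d) -> (V -> 'cV[C]_d) -> C) : Prop :=
  [/\ hilbert_space H ip, H `<=` @holo V 'cV[C]_d D &
      exists K, vreproducing_kernel D H ip K].

End VectorKernel.

End HilbertFunctionSpaces.

Section ReflectionGroups.
Variables (R : realType) (n : nat).
Local Notation C := R[i].

Definition pseudoreflection (rho : 'M[C]_n) : Prop :=
  [/\ rho \in unitmx, exists k, (0 < k)%N /\ rho ^+ k = 1%:M &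
      \rank (1%:M - rho) = 1%N].

Definition mx_group (S : set 'M[C]_n) : Prop :=
  [/\ S 1%:M,
      forall A, S A -> A \in unitmx /\ S (invmx A) &
      forall A B, S A -> S B -> S (A *m B)].

Definition generated_by_pseudoreflections (G : {fset 'M[C]_n}) : Prop :=
  exists S : set 'M[C]_n,
    S `<=` pseudoreflection /\ [set` G] = smallest mx_group S.

Definition invariant_set (G : {fset 'M[C]_n}) (D : set 'cV[C]_n) : Prop :=
  forall s, s \in G -> [set s *m z | z in D] = D.

Definition peval (q : {mpoly C[n]}) (z : 'cV[C]_n) : C :=
  meval (fun i => z i 0) q.

Definition invariant_poly (G : {fset 'M[C]_n}) (q : {mpoly C[n]}) : Prop :=
  forall s z, s \in G -> peval q (s *m z) = peval q z.

Record hsop (G : {fset 'M[C]_n}) (theta : n.-tuple {mpoly C[n]}) : Prop :=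
  Hsop {
  hsop_homog : forall i, exists k, tnth theta i \is ishomog1 k mdeg;
  hsop_invariant : forall i, invariant_poly G (tnth theta i);
  hsop_algindep : forall P : {mpoly C[n]},
    comp_mpoly theta P = 0 -> P = 0;
  hsop_gen : forall q, invariant_poly G q ->
    exists P : {mpoly C[n]}, q = comp_mpoly theta P
}.

Definition hsop_map (theta : n.-tuple {mpoly C[n]}) (z : 'cV[C]_n) :
  'cV[C]_n := \col_i peval (tnth theta i) z.

Record invariant_basis (G : {fset 'M[C]_n}) (d : nat)
    (p : 'I_d -> {mpoly C[n]}) : Prop := InvariantBasis {
  invariant_basis_span : forall q, exists c : 'I_d -> {mpoly C[n]},
    (forall k, invariant_poly G (c k)) /\ q = \sum_k c k * p k;
  invariant_basis_free : forall c : 'I_d -> {mpoly C[n]},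
    (forall k, invariant_poly G (c k)) -> \sum_k c k * p k = 0 ->
    forall k, c k = 0
}.

End ReflectionGroups.

Section AnalyticHilbertModule.
Variables (R : realType) (n : nat).
Local Notation C := R[i].
Local Notation V := 'cV[C]_n.

Definition poly_fun (Omega : set V) (q : {mpoly C[n]}) : V -> C^o :=
  (peval q : V -> C^o) \_ Omega.

Definition poly_mul (q : {mpoly C[n]}) (f : V -> C^o) : V -> C^o :=
  fun z => peval q z * f z.

Record analytic_hilbert_module (Omega : set V) (H : set (V -> C^o))
    (ip : (V -> C^o) -> (V -> C^o) -> C) (K : V -> V -> C^o) : Prop :=
  AnalyticHilbertModule {
  ahm_hilbert : hilbert_space H ip;
  ahm_holo : H `<=` @holo R V C^o Omega;
  ahm_kernel : reproducing_kernel Omega H ip K;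
  ahm_mul : forall q f, H f -> H (poly_mul q f);
  ahm_mul_bounded : forall q, exists M : C, forall f, H f ->
    ip_norm ip (poly_mul q f) <= M * ip_norm ip f;
  ahm_poly : forall q, H (poly_fun Omega q);
  ahm_dense : forall f, H f -> forall e : C, 0 < e ->
    exists q, ip_norm ip (f - poly_fun Omega q) < e
}.

Definition invariant_kernel (G : {fset 'M[C]_n}) (Omega : set V)
    (K : V -> V -> C^o) : Prop :=
  forall s z w, s \in G -> Omega z -> Omega w -> K (s *m z) (s *m w) = K z w.

End AnalyticHilbertModule.

Section Gamma.
Variables (R : realType) (n d : nat).
Local Notation C := R[i].
Local Notation V := 'cV[C]_n.
Variables (Omega : set V) (theta : n.-tuple {mpoly C[n]}).
Variable p : 'I_d -> {mpoly C[n]}.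
Variables (H : set (V -> C^o)) (ip : (V -> C^o) -> (V -> C^o) -> C).

(* O(theta(Omega)) (x) C^d is identified with the space of C^d-valued
   holomorphic functions on theta(Omega): the k-th component of [F] is the
   coefficient of the basis vector p_k in the decomposition of [f]. *)
Definition decomposition (f : V -> C^o) (F : V -> 'cV[C]_d) : Prop :=
  @holo R V 'cV[C]_d (hsop_map theta @` Omega) F /\
  forall z, Omega z ->
    f z = \sum_k peval (p k) z * F (hsop_map theta z) k 0.

(* The default value 0 of [xget] is irrelevant: by the analytic
   Chevalley-Shephard-Todd theorem every holomorphic [f] on [Omega] has exactly
   one decomposition.  Likewise for [Gamma_inv], on the image of [H]. *)
Definition Gamma (f : V -> C^o) : V -> 'cV[C]_d := xget 0 (decomposition f).

Definition tildeH : set (V -> 'cV[C]_d) := Gamma @` H.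

Definition Gamma_inv (F : V -> 'cV[C]_d) : V -> C^o :=
  xget 0 [set f | H f /\ Gamma f = F].

Definition tilde_ip (F1 F2 : V -> 'cV[C]_d) : C :=
  ip (Gamma_inv F1) (Gamma_inv F2).

End Gamma.

(* Main.v *)
From HB Require Import structures.
Require Import Defs.
From mathcomp Require Import all_boot all_order all_algebra.
From mathcomp Require Import finmap.
From mathcomp Require Import all_classical all_reals all_analysis.
From mathcomp Require Import cyclic separable cyclotomic spectral.
From mathcomp Require Import complex ring zify.
From mathcomp Require Import -(notations) mpoly.
Import Order.TTheory GRing.Theory Num.Theory.
Import numFieldNormedType.Exports.
Local Open Scope classical_set_scope.
Local Open Scope ring_scope.
Local Open Scope complex_scope.

(** The substance is the analytic Chevalley-Shephard-Todd decomposition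
    f = sum_k p_k * (F_k o theta), with F_k holomorphic on theta(Omega), for all
    f in H; once every f has exactly one such decomposition, Gamma is a linear
    bijection from H onto its image and transports the Hilbert space structure.

    For a polynomial q the decomposition is algebraic: q = sum_k p_k * (P_k o theta)
    with P_k = coords q k.  Since polynomials are dense in H, it is enough to control
    the functionals q |-> P_k(v) in the norm of H, uniformly for v near any given
    point of theta(Omega) ([component_bound], [local_bound]):
    - evaluations are locally uniformly bounded on H, because every f in H is
      continuous and a pointwise bounded sequence of functionals is bounded
      ([uniform_boundedness], [evaluation_bound]);
    - writing the decomposition at all the points s *m z with s in G gives a linear
      system for the values P_k(theta z), whose matrix is invertible on a free orbit
      ([det_orbit_mx_neq0]); Cramer's rule bounds det(z) * P_k(theta z), and the
      maximum principle on a small circle that avoids the zeros of the determinant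
      removes that factor ([division_estimate]);
    - theta is an open map ([theta_open]), so that the bound near z becomes a bound
      near theta z.  It is onto because the polynomials form a free module over
      those in theta: the multiplication operators on the fibre over v commute, and
      the eigenvalues of a common eigenvector are the coordinates of a preimage
      ([theta_surjective]).  It is open because a polynomial that vanishes on the
      orbit of z is small wherever theta is close to theta z ([orbit_vanishing]).

    By Riesz, P_k(v) is the inner product of q with an element of H, the
    [component_kernel].  For f in H the function F_k is defined by the inner products
    of f with these elements.  Cauchy estimates bound the partial derivatives of P_k
    and the remainder of its first order expansion, hence these are represented by
    elements of H too, and density extends the expansion, with its quadratic error
    term, from polynomials to H: F_k is complex differentiable.  The decomposition of
    f extends by density in the same way, and it is unique because the orbit matrix
    is invertible on a dense set.  Finally the component kernels provide the matrix
    reproducing kernel of Gamma(H), which is antiholomorphic in its second variable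
    by Hermitian symmetry. *)

Set Implicit Arguments.
Unset Strict Implicit.
Unset Printing Implicit Defensive.

(** * Hilbert spaces given by a subset of a vector space *)

Section HilbertSpace.
Variables (R : realType) (E : lmodType R[i]).
Local Notation C := R[i].
Variables (H : set E) (ip : E -> E -> C).
Hypothesis hH : hilbert_space H ip.
Local Notation N := (ip_norm ip).

Lemma hilbertD f g : H f -> H g -> H (f + g).
Proof. by move=> hf hg; rewrite -[f]scale1r; apply: hilbertP hH _ _ _ hf hg. Qed.

Lemma hilbertZ a f : H f -> H (a *: f).
Proof.
by move=> hf; rewrite -[_ *: _]addr0; apply: hilbertP hH _ _ _ hf (hilbert0 hH).
Qed.

Lemma hilbertB f g : H f -> H g -> H (f - g).
Proof. by move=> hf hg; rewrite -scaleN1r; apply: hilbertD => //; exact: hilbertZ. Qed.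

Lemma hilbert_sum (I : Type) (r : seq I) (P : pred I) (F : I -> E) :
  (forall i, P i -> H (F i)) -> H (\sum_(i <- r | P i) F i).
Proof. by move=> hF; elim/big_ind : _ => //; [exact: hilbert0 hH | exact: hilbertD]. Qed.

Lemma ipDl f g h : H f -> H g -> H h -> ip (f + g) h = ip f h + ip g h.
Proof. by move=> hf hg hh; rewrite -[f]scale1r (hilbert_ipP hH) // mul1r scale1r. Qed.

Lemma ip0l h : H h -> ip 0 h = 0.
Proof.
move=> hh; have h0 := hilbert0 hH.
by have /eqP := ipDl h0 h0 hh; rewrite addr0 -subr_eq0 opprD addrA subrr sub0r oppr_eq0 => /eqP.
Qed.

Lemma ipZl a f h : H f -> H h -> ip (a *: f) h = a * ip f h.
Proof.
move=> hf hh; have h0 := hilbert0 hH.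
by rewrite -[_ *: _]addr0 (hilbert_ipP hH) // ip0l // addr0.
Qed.

Lemma ipBl f g h : H f -> H g -> H h -> ip (f - g) h = ip f h - ip g h.
Proof.
move=> hf hg hh; rewrite -[- g]scaleN1r ipDl ?ipZl ?mulN1r //.
exact: hilbertZ.
Qed.

Lemma ipDr f g h : H f -> H g -> H h -> ip h (f + g) = ip h f + ip h g.
Proof.
move=> hf hg hh; have hfg := hilbertD hf hg.
rewrite (hilbert_ipC hH hfg hh) ipDl // rmorphD /=.
by rewrite -(hilbert_ipC hH hf hh) -(hilbert_ipC hH hg hh).
Qed.

Lemma ipZr a f h : H f -> H h -> ip h (a *: f) = Num.conj a * ip h f.
Proof.
move=> hf hh; have haf := hilbertZ a hf.
by rewrite (hilbert_ipC hH haf hh) ipZl // rmorphM /= -(hilbert_ipC hH hf hh).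
Qed.

Lemma ipBr f g h : H f -> H g -> H h -> ip h (f - g) = ip h f - ip h g.
Proof.
move=> hf hg hh; have hfg := hilbertB hf hg.
rewrite (hilbert_ipC hH hfg hh) ipBl // rmorphB /=.
by rewrite -(hilbert_ipC hH hf hh) -(hilbert_ipC hH hg hh).
Qed.

Lemma ip0r h : H h -> ip h 0 = 0.
Proof. by move=> hh; rewrite -(subrr h) ipBr // subrr. Qed.

Lemma ip_suml (I : Type) (r : seq I) (F : I -> E) h :
  (forall i, H (F i)) -> H h -> ip (\sum_(i <- r) F i) h = \sum_(i <- r) ip (F i) h.
Proof.
move=> hF hh; elim: r => [|i r IH]; first by rewrite !big_nil ip0l.
by rewrite !big_cons ipDl ?IH //; apply: hilbert_sum.
Qed.

Lemma ip_sumr (I : Type) (r : seq I) (F : I -> E) h :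
  (forall i, H (F i)) -> H h -> ip h (\sum_(i <- r) F i) = \sum_(i <- r) ip h (F i).
Proof.
move=> hF hh; elim: r => [|i r IH]; first by rewrite !big_nil ip0r.
by rewrite !big_cons ipDr ?IH //; apply: hilbert_sum.
Qed.

Lemma ip_norm_sqr f : N f ^+ 2 = ip f f.
Proof. exact: sqrtCK. Qed.

Lemma ip_norm_ge0 f : H f -> 0 <= N f.
Proof. by move=> hf; rewrite sqrtC_ge0; apply: hilbert_ip_ge0 hH _ hf. Qed.

Lemma ip_norm0 : N 0 = 0.
Proof. by rewrite /ip_norm ip0l ?sqrtC0 //; exact: hilbert0 hH. Qed.

Lemma ip_norm_eq0 f : H f -> N f = 0 -> f = 0.
Proof.
by move=> hf Nf; apply: (hilbert_ip_eq0 hH) => //; rewrite -ip_norm_sqr Nf expr0n.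
Qed.

Lemma ip_normZ a f : H f -> N (a *: f) = `|a| * N f.
Proof.
move=> hf; have hZ := hilbertZ a hf.
apply/eqP; rewrite -(@eqrXn2 _ 2) ?mulr_ge0 ?ip_norm_ge0 //.
by rewrite exprMn !ip_norm_sqr ipZl // ipZr // normCK mulrA.
Qed.

Lemma ip_normN f : H f -> N (- f) = N f.
Proof. by move=> hf; rewrite -scaleN1r ip_normZ // normrN1 mul1r. Qed.

Lemma ip_norm_distC f g : H f -> H g -> N (f - g) = N (g - f).
Proof. by move=> hf hg; rewrite -ip_normN ?opprB //; exact: hilbertB. Qed.

Lemma norm_ipC f g : H f -> H g -> `|ip f g| = `|ip g f|.
Proof. by move=> hf hg; rewrite (hilbert_ipC hH hf hg) norm_conjC. Qed.

Lemma cauchy_schwarz f g : H f -> H g -> `|ip f g| <= N f * N g.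
Proof.
move=> hf hg; have [Ng0|Ng0] := eqVneq (N g) 0.
  by rewrite (ip_norm_eq0 hg Ng0) ip0r // normr0 ip_norm0 mulr0.
have gg : 0 < ip g g by rewrite -ip_norm_sqr exprn_gt0 // lt_def Ng0 ip_norm_ge0.
have [h1 h2] : H (ip g g *: f) /\ H (ip f g *: g) by split; exact: hilbertZ.
have h3 := hilbertB h1 h2.
have cg : Num.conj (ip g g) = ip g g by rewrite -(hilbert_ipC hH hg hg).
have := hilbert_ip_ge0 hH h3.
rewrite ipBl // !ipBr // !ipZl // !ipZr // cg.
have -> : ip g g * (ip g g * ip f f) - ip g g * (Num.conj (ip f g) * ip f g)
   - (ip f g * (ip g g * ip g f) - ip f g * (Num.conj (ip f g) * ip g g))
   = ip g g * (ip f f * ip g g - `|ip f g| ^+ 2).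
  by rewrite normCK (hilbert_ipC hH hf hg); ring.
rewrite pmulr_rge0 // subr_ge0 -!ip_norm_sqr -exprMn.
by rewrite ler_pXn2r // nnegrE ?mulr_ge0 ?ip_norm_ge0.
Qed.

Lemma ip_normD f g : H f -> H g -> N (f + g) <= N f + N g.
Proof.
move=> hf hg; have hfg := hilbertD hf hg.
rewrite -(@ler_pXn2r _ 2) ?nnegrE ?addr_ge0 ?ip_norm_ge0 //.
rewrite sqrrD !ip_norm_sqr ipDl // !ipDr //.
have -> : ip f f + ip f g + (ip g f + ip g g) = ip f f + (ip f g + ip g f) + ip g g.
  by ring.
rewrite lerD2r lerD2l.
have fgr : ip f g + ip g f \is Num.real.
  by apply/CrealP; rewrite rmorphD /= -(hilbert_ipC hH hf hg) -(hilbert_ipC hH hg hf) addrC.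
apply: le_trans (real_ler_norm fgr) _; apply: le_trans (ler_normD _ _) _.
rewrite (norm_ipC hg hf) // -mulr2n.
by rewrite lerMn2r cauchy_schwarz.
Qed.

End HilbertSpace.

(** * Riesz representation and uniform boundedness *)

Section Estimates.
Variable R : realType.
Local Notation C := R[i].

Lemma invS_eventually_lt (e : C) : 0 < e ->
  exists N, forall k, (N <= k)%N -> k.+1%:R^-1 < e.
Proof.
move=> e0; have /complex_realP[r er] := gtr0_real e0.
move: e0; rewrite er ltcR => r0.
have [N _ HN] := near_infty_natSinv_lt (PosNum r0).
exists N => k Nk; have /= := HN k Nk.
by rewrite -ltcR fmorphV rmorph_nat.
Qed.

Lemma ler_of_small (x y c : C) : 0 <= c ->
  (forall e, 0 < e -> x <= y + e * c) -> x <= y.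
Proof.
move=> c0 hx; apply/ler_addgt0Pr => e e0.
have c1 : 0 < c + 1 by rewrite ltr_wpDl.
apply: le_trans (hx (e / (c + 1)) (divr_gt0 e0 c1)) _.
rewrite lerD2l mulrAC ler_pdivrMr // ler_pM2l //.
by rewrite lerDl.
Qed.

Lemma eq0_of_small (x c : C) : 0 <= c -> (forall e, 0 < e -> `|x| <= e * c) -> x = 0.
Proof.
move=> c0 hx; apply/eqP; rewrite -normr_le0.
by apply: ler_of_small c0 _ => e e0; rewrite add0r hx.
Qed.

Lemma natr_unbounded (B : C) : 0 <= B -> exists k : nat, B <= k%:R.
Proof.
move=> B0; have B1 : 0 < B + 1 by rewrite ltr_wpDl.
have Bi : 0 < (B + 1)^-1 by rewrite invr_gt0.
have [k hk] := invS_eventually_lt Bi; exists k.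
have := hk k (leqnn k); rewrite ltf_pV2 ?posrE // -natr1 ltrD2r.
exact: ltW.
Qed.

Lemma ltr_of_sqr (a b : C) : 0 <= a -> 0 < b -> a ^+ 2 < b ^+ 2 -> a < b.
Proof. by move=> a0 b0; rewrite ltr_pXn2r // nnegrE ltW. Qed.

End Estimates.

Section HilbertTheorems.
Variables (R : realType) (E : lmodType R[i]).
Local Notation C := R[i].
Variables (H : set E) (ip : E -> E -> C).
Hypothesis hH : hilbert_space H ip.
Local Notation N := (ip_norm ip).

(** The range of [iota] need not be closed, so there is no orthogonal projection onto it.
    The representing vector is the limit in [H] of a minimizing sequence of the functional
    |f|^2 - 2 Re (phi f) on that range, which is Cauchy by the parallelogram identity. *)
Lemma riesz (U : lmodType C) (iota : U -> E) (phi : U -> C^o) (M : C) :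
  linear iota -> (forall u, H (iota u)) -> scalar phi -> 0 <= M ->
  (forall u, `|phi u| <= M * N (iota u)) ->
  exists2 kappa, H kappa & forall u, phi u = ip (iota u) kappa.
Proof.
move=> ioL ioH phL M0 phM.
pose J u := ip (iota u) (iota u) - (phi u + Num.conj (phi u)).
have ioS (a : C) u v : iota (v + a *: u) = a *: iota u + iota v by rewrite addrC ioL.
have phS (a : C) u v : phi (v + a *: u) = a * phi u + phi v by rewrite addrC phL.
have ioD u v : iota (u + v) = iota u + iota v by rewrite -[u]scale1r ioL !scale1r.
have phD u v : phi (u + v) = phi u + phi v by rewrite -{1}[u]scale1r phL mul1r.
have io0 : iota 0 = 0 by have := ioL (-1) 0 0; rewrite scaler0 addr0 scaleN1r addNr.
have ph0 : phi 0 = 0.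
  by have := phL (-1) 0 0; rewrite scaler0 addr0 mulN1r addNr.
have ioZ (a : C) u : iota (a *: u) = a *: iota u by rewrite -[_ *: u]add0r ioS io0 addr0.
have phZ (a : C) u : phi (a *: u) = a * phi u by rewrite -[_ *: u]add0r phS ph0 addr0.
have N0 u : 0 <= N (iota u) by apply: ip_norm_ge0 hH _ _.
have Jlow u : - (M ^+ 2) <= J u.
  have : phi u + Num.conj (phi u) <= 2 * (M * N (iota u)).
    have rp : phi u + Num.conj (phi u) \is Num.real.
      by apply/CrealP; rewrite rmorphD /= conjCK addrC.
    apply: le_trans (real_ler_norm rp) _; apply: le_trans (ler_normD _ _) _.
    by rewrite norm_conjC -mulr2n mulr_natl lerMn2r phM orbT.
  rewrite /J -(ip_norm_sqr ip) => h; rewrite lerBrDr; apply: le_trans (lerD (lexx _) h) _.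
  rewrite -subr_ge0.
  have -> : N (iota u) ^+ 2 - (- M ^+ 2 + 2 * (M * N (iota u))) = (N (iota u) - M) ^+ 2.
    by ring.
  by rewrite real_exprn_even_ge0 // realB // ger0_real.
have Jreal u : (complex.Re (J u))%:C = J u.
  apply: RRe_real; rewrite -(subrK (- M ^+ 2) (J u)) realD ?realN ?realX ?ger0_real //.
  by rewrite subr_ge0.
pose S := [set complex.Re (J u) | u in setT].
have Sinf : has_inf S.
  split; first by exists (complex.Re (J 0)); exists 0.
  exists (complex.Re (- M ^+ 2)) => _ [u _ <-].
  by have := Jlow u; rewrite lecE => /andP[].
pose m : C := (inf S)%:C.
have hm u : m <= J u.
  by rewrite -Jreal lecR; apply: ge_inf; [exact: Sinf.2 | exists u].
have /choice[w hw] (j : nat) : exists u, J u - m < j.+1%:R^-1.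
  have [|_ [u _ <-] hu] := @inf_adherent _ S j.+1%:R^-1 _ Sinf; first by rewrite invr_gt0.
  exists u; rewrite ltrBlDr addrC -Jreal -(rmorph_nat (real_complex R)) -fmorphV.
  by rewrite -rmorphD /= ltcR.
(* The midpoint of two near minimizers is no better than the infimum [m]. *)
have para u v : N (iota u - iota v) ^+ 2 =
    2 * (J u - m) + 2 * (J v - m) - 4 * (J (2^-1 *: (u + v)) - m).
  have eq1 : iota (2^-1 *: (u + v)) = 2^-1 *: (iota u + iota v) by rewrite ioZ ioD.
  have eq2 : phi (2^-1 *: (u + v)) = 2^-1 * (phi u + phi v) by rewrite phZ phD.
  have c2 : Num.conj (2^-1 : C) = 2^-1 by rewrite fmorphV /= rmorph_nat.
  have [hu hv] : H (iota u) /\ H (iota v) by split.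
  rewrite /J eq1 eq2 ip_norm_sqr rmorphM rmorphD /= c2.
  have hD := hilbertD hH hu hv; have hZ := hilbertZ hH 2^-1 hD.
  have hB := hilbertB hH hu hv.
  rewrite (ipBl hH) // !(ipBr hH) // (ipZl hH) // (ipZr hH) // (ipDl hH) // !(ipDr hH) // c2.
  by field.
have key u v : N (iota u - iota v) ^+ 2 <= 2 * (J u - m) + 2 * (J v - m).
  by rewrite para gerBl mulr_ge0 // subr_ge0.
have NB u v : 0 <= N (iota u - iota v) by apply: ip_norm_ge0 hH _ _; exact: hilbertB hH _ _ _ _.
have [component_kernel hkap lim] : exists2 f, H f & forall e : C, 0 < e -> exists n0, forall k,
    (n0 <= k)%N -> N (iota (w k) - f) < e.
  apply: (hilbert_complete hH) => [k|e e0]; first exact: ioH.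
  have e4 : 0 < e ^+ 2 / 4 by rewrite divr_gt0 // exprn_gt0.
  have [n0 hn0] := invS_eventually_lt e4; exists n0 => k l hk hl.
  apply: ltr_of_sqr => //; apply: le_lt_trans (key _ _) _.
  have -> : e ^+ 2 = 2 * (e ^+ 2 / 4) + 2 * (e ^+ 2 / 4) by field.
  by rewrite ltrD // ltr_pM2l // (lt_trans (hw _)) // hn0.
exists component_kernel => // u; apply/eqP; rewrite -subr_eq0; apply/eqP.
pose c := ip (iota u) (iota u); have c0 : 0 <= c by apply: hilbert_ip_ge0 hH _ _.
have c1 : 0 < c + 1 by rewrite ltr_wpDl.
apply: (@eq0_of_small _ _ (c + 1 + N (iota u))) => [|e e0]; first by rewrite addr_ge0 // ltW.
have [n1 hn1] := invS_eventually_lt (exprn_gt0 2 e0); have [n2 hn2] := lim e e0.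
pose j := maxn n1 n2; set wj := w j.
(* Moving [wj] by [s] in the direction [u] decreases [J] by a multiple of |b|^2, which
   is at most the distance from J(wj) to the infimum. *)
pose b := ip (iota u) (iota wj) - phi u.
have hb : `|b| <= e * (c + 1).
  pose lam := (c + 1)^-1; pose s : C := - (lam * Num.conj b).
  have lam0 : 0 < lam by rewrite invr_gt0.
  have lc : Num.conj lam = lam by rewrite geC0_conj // ltW.
  have [hu hwj] : H (iota u) /\ H (iota wj) by split.
  have hZ := hilbertZ hH s hu; have hD := hilbertD hH hZ hwj.
  have E1 : J (wj + s *: u) = J wj - (2 * lam - lam ^+ 2 * c) * `|b| ^+ 2.
    rewrite /J ioS phS (ipDl hH) // !(ipDr hH) // (ipZl hH) // !(ipZr hH) // (ipZl hH) //.
    have cs : Num.conj s = - (lam * b) by rewrite rmorphN rmorphM /= conjCK lc.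
    rewrite rmorphD rmorphM /= normCK cs /s (hilbert_ipC hH hu hwj).
    have -> : Num.conj (phi u) = Num.conj (ip (iota u) (iota wj)) - Num.conj b.
      by rewrite /b rmorphB /= opprB addrC subrK.
    have -> : phi u = ip (iota u) (iota wj) - b by rewrite /b opprB addrC subrK.
    rewrite /c.
    by ring.
  have h1 : (2 * lam - lam ^+ 2 * c) * `|b| ^+ 2 <= J wj - m.
    by rewrite lerBrDr -lerBrDl -E1.
  have h2 : lam * `|b| ^+ 2 <= e ^+ 2.
    apply: le_trans (le_trans h1 (ltW (lt_trans (hw j) _))); last first.
      by rewrite hn1 // leq_maxl.
    apply: ler_wpM2r; first by rewrite exprn_ge0.
    rewrite -subr_ge0.
    have -> : 2 * lam - lam ^+ 2 * c - lam = lam * (lam * (c + 1 - c)).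
      by rewrite /lam; field; rewrite gt_eqF.
    by rewrite addrAC subrr add0r mulr1 mulr_ge0 // ltW.
  rewrite -(@ler_pXn2r _ 2) ?nnegrE ?mulr_ge0 ?(ltW e0) ?(ltW c1) //.
  rewrite exprMn expr2 [X in _ <= _ * X]expr2 mulrA.
  apply: (@le_trans _ _ (e ^+ 2 * (c + 1))).
    by rewrite -ler_pdivrMr // mulrC -expr2.
  rewrite ler_peMr ?lerDr // mulr_ge0 ?exprn_ge0 ?(ltW e0) ?(ltW c1) //.
have -> : phi u - ip (iota u) component_kernel = - b + ip (iota u) (iota wj - component_kernel).
  by rewrite /b (ipBr hH) //; ring.
apply: le_trans (ler_normD _ _) _; rewrite normrN mulrDr lerD //.
have hB := hilbertB hH (ioH wj) hkap.
apply: le_trans (cauchy_schwarz hH _ _) _ => //.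
by rewrite mulrC ler_wpM2r // ltW // hn2 // leq_maxr.
Qed.

(** This transfers to all of [H] every identity or estimate between finite combinations
    of represented functionals that is known on a dense set. *)
Lemma weak_dense_bound (U : Type) (iota : U -> E) (kappa : E) (c : C) :
  (forall u, H (iota u)) -> H kappa -> 0 <= c ->
  (forall f, H f -> forall e, 0 < e -> exists u, N (f - iota u) < e) ->
  (forall u, `|ip (iota u) kappa| <= c * N (iota u)) ->
  forall f, H f -> `|ip f kappa| <= c * N f.
Proof.
move=> ioH hk c0 dense hc f hf.
have Nk := ip_norm_ge0 hH hk.
apply: (@ler_of_small _ _ _ (N kappa + c)) => [|e e0]; first by rewrite addr_ge0.
have [u hu] := dense f hf e e0.
have hio := ioH u; have hB := hilbertB hH hf hio.
have -> : ip f kappa = ip (f - iota u) kappa + ip (iota u) kappa.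
  by rewrite (ipBl hH) // subrK.
apply: le_trans (ler_normD _ _) _.
have h1 : `|ip (f - iota u) kappa| <= e * N kappa.
  by apply: le_trans (cauchy_schwarz hH _ _) _ => //; rewrite ler_wpM2r // ltW.
have h2 : N (iota u) <= N f + e.
  have -> : iota u = f + (iota u - f) by rewrite addrC subrK.
  apply: le_trans (ip_normD hH _ _) _ => //; first exact: (hilbertB hH).
  by rewrite lerD2l (ip_norm_distC hH) // ltW.
apply: le_trans (lerD h1 (le_trans (hc u) (ler_wpM2l c0 h2))) _.
by rewrite !mulrDr [c * e]mulrC addrCA.
Qed.

(** Of the two vectors x + v and x - v, at least one pairs with [g] at least as strongly
    as v does, by the triangle inequality. *)
Lemma gliding_hump_step (x g : E) (c : C) : H x -> H g -> 0 <= c ->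
  exists y, [/\ H y, N (y - x) <= c & c * N g <= `|ip y g| ].
Proof.
move=> hx hg c0; have Ng := ip_norm_ge0 hH hg.
have [Ng0|Ng0] := eqVneq (N g) 0.
  by exists x; rewrite subrr (ip_norm0 hH) Ng0 mulr0; split.
pose a := ip x g; pose b : C := c * N g.
have b0 : 0 <= b by rewrite mulr_ge0.
have try (s : C) : `|s| = 1 -> b <= `|a + s * b| ->
    exists y, [/\ H y, N (y - x) <= c & c * N g <= `|ip y g| ].
  move=> s1 hs; exists (x + (s * (c / N g)) *: g).
  have hZ := hilbertZ hH (s * (c / N g)) hg; split; first exact: (hilbertD hH).
    rewrite addrAC subrr add0r (ip_normZ hH) // normrM s1 mul1r normf_div.
    by rewrite (ger0_norm c0) (ger0_norm Ng) divfK.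
  rewrite (ipDl hH) // (ipZl hH) //.
  suff <- : s * b = s * (c / N g) * ip g g by [].
  by rewrite -ip_norm_sqr /b; field.
have [h|h1] := boolP (b <= `|a + 1 * b|); first by apply: try h; rewrite normr1.
have [h|h2] := boolP (b <= `|a + (-1) * b|); first by apply: try h; rewrite normrN1.
have h1' : `|a + b| < b.
  by rewrite real_ltNge ?normr_real ?ger0_real //; move: h1; rewrite mul1r.
have h2' : `|a - b| < b.
  by rewrite real_ltNge ?normr_real ?ger0_real //; move: h2; rewrite mulN1r.
have := le_lt_trans (ler_normB _ _) (ltrD h1' h2').
have -> : a + b - (a - b) = 2 * b by ring.
by rewrite ger0_norm ?mulr_ge0 // mulr_natl mulr2n ltxx.
Qed.

(** Gliding gliding_hump_step: if the norms were unbounded, a subsequence [g] would grow faster than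
    3^k * k, and steps of length 3^-k could be chosen so that the k-th one makes the
    pairing with g_k large while all the later ones together are too short to undo it.
    The limit of the steps contradicts pointwise boundedness. *)
Lemma uniform_boundedness (kappa : nat -> E) : (forall j, H (kappa j)) ->
  (forall f, H f -> exists B : C, forall j, `|ip f (kappa j)| <= B) ->
  exists B : C, forall j, N (kappa j) <= B.
Proof.
move=> hk pw; apply: contrapT => unb.
have big k : exists j, 3 ^+ k * k%:R < N (kappa j).
  apply: contrapT => nb; apply: unb; exists (3 ^+ k * k%:R) => j.
  have [//|h] := boolP (N (kappa j) <= 3 ^+ k * k%:R).
  exfalso; apply: nb; exists j; rewrite real_ltNge ?ger0_real //.
by apply: ip_norm_ge0 hH _ _.
have [sel hsel] := choice big.
pose g k := kappa (sel k); have hg k : H (g k) by exact: hk.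
pose t k : C := 3 ^- k; have t0 k : 0 <= t k by rewrite /t invr_ge0 exprn_ge0.
have /choice[st hst] (xk : E * nat) : exists y, H xk.1 ->
    [/\ H y, N (y - xk.1) <= t xk.2 & t xk.2 * N (g xk.2) <= `|ip y (g xk.2)| ].
  case: xk => x k /=.
  have [hx|nx] := pselect (H x); last by exists 0.
  by have [y hy] := gliding_hump_step hx (hg k) (t0 k); exists y.
pose x := fix x k := if k is k'.+1 then st (x k', k') else 0.
have hx k : H (x k).
  by elim: k => [|k IH]; [exact: hilbert0 hH | have [] := hst (x k, k) IH].
have xS k : N (x k.+1 - x k) <= t k by have [] := hst (x k, k) (hx k).
have xg k : t k * N (g k) <= `|ip (x k.+1) (g k)| by have [] := hst (x k, k) (hx k).
have NB k l : 0 <= N (x k - x l) by apply: ip_norm_ge0 hH _ _; exact: (hilbertB hH).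
have tS k : t k = 3 * t k.+1 by rewrite /t exprS invfM mulrA divff // mul1r.
have dist k j : N (x (k + j)%N - x k) <= 3 / 2 * (t k - t (k + j)%N).
  elim: j => [|j IH]; first by rewrite addn0 !subrr (ip_norm0 hH) mulr0.
  rewrite addnS.
  have -> : x (k + j).+1 - x k = (x (k + j).+1 - x (k + j)%N) + (x (k + j)%N - x k).
    by rewrite addrA subrK.
  apply: le_trans (ip_normD hH _ _) _; [exact: (hilbertB hH)|exact: (hilbertB hH)|].
  apply: le_trans (lerD (xS _) IH) _.
  by rewrite (tS (k + j)%N) le_eqVlt; apply/orP; left; apply/eqP; field.
have dist' k l : (k <= l)%N -> N (x l - x k) <= 3 / 2 * t k.
  move=> /subnKC <-; apply: le_trans (dist _ _) _.
  by rewrite ler_pM2l // gerBl.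
have [f hf lim] : exists2 f, H f & forall e : C, 0 < e -> exists n0, forall k,
    (n0 <= k)%N -> N (x k - f) < e.
  apply: (hilbert_complete hH) => // e e0.
  have e3 : 0 < e / 3 by rewrite divr_gt0.
  have [n0 hn0] := invS_eventually_lt e3; exists n0.
  have wl k l : (n0 <= k)%N -> (k <= l)%N -> N (x l - x k) < e.
    move=> n0k kl; apply: le_lt_trans (dist' _ _ kl) _.
    have tk : t k < e / 3.
      apply: le_lt_trans (hn0 k n0k); rewrite /t lef_pV2 ?posrE ?exprn_gt0 //.
      by rewrite -natrX ler_nat ltn_expl.
    apply: (@le_lt_trans _ _ (3 * t k)); last by rewrite mulrC -ltr_pdivlMr.
    by rewrite ler_wpM2r // ler_pdivrMr // ler_peMr // ler1n.
  move=> k l lek lel; have [kl|/ltnW lk] := leqP k l; last exact: wl.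
  by rewrite (ip_norm_distC hH) //; exact: wl.
have [B hB] := pw f hf.
have lower k : k%:R <= 4 * B.
  have tk : 0 < t k / 4 by rewrite divr_gt0 // invr_gt0 exprn_gt0.
  have [n0 hn0] := lim _ tk; pose l := maxn n0 k.+1.
  have d1 : N (x k.+1 - f) <= 3 / 4 * t k.
    have -> : x k.+1 - f = (x k.+1 - x l) + (x l - f) by rewrite addrA subrK.
    apply: le_trans (ip_normD hH _ _) _; [exact: (hilbertB hH)|exact: (hilbertB hH)|].
    rewrite (ip_norm_distC hH) //.
    have h1 := dist' k.+1 l (leq_maxr _ _); have h2 := ltW (hn0 l (leq_maxl _ _)).
    apply: le_trans (lerD h1 h2) _.
    by rewrite (tS k) le_eqVlt; apply/orP; left; apply/eqP; field.
  have gk0 := ip_norm_ge0 hH (hg k).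
  have h1 : t k * N (g k) <= `|ip f (g k)| + 3 / 4 * t k * N (g k).
    apply: le_trans (xg k) _.
    have -> : ip (x k.+1) (g k) = ip f (g k) + ip (x k.+1 - f) (g k).
      by rewrite (ipBl hH) // addrC subrK.
    apply: le_trans (ler_normD _ _) _; rewrite lerD2l.
    have hxf := hilbertB hH (hx k.+1) hf.
    apply: le_trans (cauchy_schwarz hH _ _) _ => //.
    exact: ler_wpM2r.
  have h2 : t k * N (g k) <= 4 * B.
    have := le_trans h1 (lerD (hB (sel k)) (lexx _)); rewrite -lerBlDr => h3.
    have -> : t k * N (g k) = 4 * (t k * N (g k) - 3 / 4 * t k * N (g k)) by field.
    by rewrite ler_pM2l.
  apply: le_trans h2; rewrite /t mulrC ler_pdivlMr ?exprn_gt0 // mulrC ltW //.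
have B0 : 0 <= B by apply: le_trans (hB 0%N).
have B41 : 0 <= 4 * B + 1 by rewrite addr_ge0 // mulr_ge0.
have [k kB] := natr_unbounded B41.
by have := le_trans kB (lower k); rewrite gerDl ler10.
Qed.

End HilbertTheorems.

(** * Estimates for polynomials *)

Section OneVariable.
Variable C : numClosedFieldType.

Lemma prim_root_exists (m : nat) : (0 < m)%N -> exists z : C, m.-primitive_root z.
Proof.
pose p : {poly C} := 'X^m - 1; have [r Dp] := closed_field_poly_normal p.
move=> m_gt0; rewrite (monicP _) ?monicXnsubC // scale1r in Dp.
have rn1: all m.-unity_root r by apply/allP=> z; rewrite -root_prod_XsubC -Dp.
have sz_r: (m < (size r).+1)%N.
  by rewrite -(size_prod_XsubC r id) -Dp size_XnsubC.
have [|z] := hasP (has_prim_root m_gt0 rn1 _ sz_r); last by exists z.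
by rewrite -separable_prod_XsubC -Dp separable_Xn_sub_1 // pnatr_eq0 -lt0n.
Qed.

(** Orthogonality of the characters of the m-th roots of unity. *)
Lemma sum_prim_root (m i : nat) (z : C) : m.-primitive_root z ->
  \sum_(j < m) (z ^+ i) ^+ j = if (m %| i)%N then m%:R else 0.
Proof.
move=> zp; rewrite (prim_order_dvd zp); have [->|zi1] := eqVneq (z ^+ i) 1.
  by rewrite (eq_bigr (fun=> 1)) => [|j _]; rewrite ?expr1n // sumr_const card_ord.
have zim : (z ^+ i) ^+ m = 1 by rewrite exprAC (prim_expr_order zp) expr1n.
have /esym/eqP := subrX1 (z ^+ i) m; rewrite zim subrr mulf_eq0 subr_eq0.
by rewrite (negPf zi1) => /eqP.
Qed.

(** Cauchy's integral formula becomes an exact finite average over the circle for a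
    polynomial: sum over the m-th roots of unity, with m larger than the degree. *)
Lemma cauchy_coef (g : {poly C}) (rho M : C) (k : nat) : 0 < rho ->
  (forall t, `|t| = rho -> `|g.[t]| <= M) -> `|g`_k| * rho ^+ k <= M.
Proof.
move=> rho0 gM; have M0 : 0 <= M.
  by apply: le_trans (gM rho _); rewrite // gtr0_norm.
have [sk|ks] := leqP (size g) k; first by rewrite nth_default // normr0 mul0r.
set m := size g in ks; have m0 : (0 < m)%N by apply: leq_ltn_trans ks.
have [z zp] := prim_root_exists m0.
have z1 : `|z| = 1.
  apply/eqP; rewrite -(@pexpr_eq1 _ _ m) // -normrX (prim_expr_order zp).
  by rewrite normr1.
(* The exponent m - k stands for -k, modulo m. *)
pose S := \sum_(j < m) g.[rho * z ^+ j] * (z ^+ (m - k)) ^+ j.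
have SE : S = m%:R * (g`_k * rho ^+ k).
  rewrite /S; under eq_bigr => j _ do rewrite horner_coef mulr_suml.
  rewrite exchange_big /= (bigD1 (Ordinal ks)) //= [X in _ + X]big1 ?addr0; last first.
    move=> i ik; rewrite (eq_bigr (fun j : 'I_m => (g`_i * rho ^+ i) *
        (z ^+ (i + (m - k))) ^+ j)); last first.
      by move=> j _; rewrite exprMn exprD exprMn -!exprM [(j * i)%N]mulnC !mulrA.
    rewrite -mulr_sumr sum_prim_root //; case: ifP => [/dvdnP[q hq]|_]; last by rewrite mulr0.
    exfalso; move/eqP: ik; apply; apply: val_inj => /=.
    have iM := ltn_ord i; rewrite -/m in iM; case: q hq => [|[|q]] hq; nia.
  rewrite (eq_bigr (fun j : 'I_m => (g`_k * rho ^+ k) * (z ^+ m) ^+ j)); last first.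
    move=> j _; have -> : z ^+ m = z ^+ k * z ^+ (m - k) by rewrite -exprD subnKC // ltnW.
    by rewrite !exprMn -!exprM [(j * k)%N]mulnC !mulrA.
  by rewrite -mulr_sumr sum_prim_root // dvdnn mulrC.
have : `|S| <= m%:R * M.
  apply: le_trans (ler_norm_sum _ _ _) _.
  apply: (@le_trans _ _ (\sum_(j < m) M)); last first.
    by rewrite sumr_const card_ord mulr_natl.
  apply: ler_sum => j _; rewrite normrM !normrX z1 !expr1n mulr1.
  by apply: gM; rewrite normrM normrX z1 expr1n mulr1 gtr0_norm.
rewrite SE normrM normr_nat ler_pM2l ?ltr0n // normrM normrX.
by rewrite (gtr0_norm rho0).
Qed.

Lemma exists_radius_notin (s : seq C) (e : C) : 0 < e -> exists2 rho, 0 < rho < e & rho \notin s.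
Proof.
move=> e0; pose c (j : 'I_(size s).+1) := e / j.+2%:R.
have cinj : injective c.
  move=> i j /(mulfI (lt0r_neq0 e0)) /invr_inj /eqP; rewrite eqr_nat => /eqP[].
  by move/val_inj.
have [/allP sub|/allPn[x /mapP[j _ ->] xs]] :=
  boolP (all (mem s) [seq c j | j <- enum 'I_(size s).+1]).
  have := uniq_leq_size _ sub; rewrite size_map size_enum_ord ltnn.
  by rewrite map_inj_uniq ?enum_uniq // => /(_ isT).
exists (c j) => //; rewrite divr_gt0 //= /c ltr_pdivrMr //.
by rewrite ltr_pMr // ltr1n.
Qed.

(** A radius that differs from the moduli of all the roots keeps each linear factor away
    from 0 on the whole circle. *)
Lemma circle_lower_bound (l : {poly C}) (e : C) : l != 0 -> 0 < e ->
  exists rho d, [/\ 0 < rho, rho < e, 0 < d & forall t, `|t| = rho -> d <= `|l.[t]| ].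
Proof.
move=> l0 e0; have [s Dl] := closed_field_poly_normal l.
have [rho /andP[rho0 rhoe] rhos] := exists_radius_notin [seq `|a| | a <- s] e0.
exists rho, (`|lead_coef l| * \prod_(a <- s) `|rho - `|a| |); split => //.
  rewrite mulr_gt0 ?normr_gt0 ?lead_coef_eq0 // big_seq prodr_gt0 // => a sa.
  rewrite normr_gt0 subr_eq0; apply: contraNneq rhos => ->.
  by apply/mapP; exists a.
move=> t tr; rewrite {2}Dl hornerZ normrM ler_wpM2l // horner_prod normr_prod.
rewrite ler_prod // => a _; rewrite normr_ge0 /= !hornerE -tr.
exact: ler_dist_dist.
Qed.

End OneVariable.

Section MatrixNorm.
Variables (C : numFieldType) (m n : nat).

Lemma mx_entry_le (z : 'M[C]_(m, n)) i j : `|z i j| <= `|z|.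
Proof.
rewrite [leRHS]/Num.norm /= mx_normE -[leLHS]nngE num_le.
exact: (le_bigmax _ (fun ij : 'I_m * 'I_n => `|z ij.1 ij.2|%:nng) (i, j)).
Qed.

Lemma mx_norm_le (z : 'M[C]_(m, n)) (B : C) : 0 <= B ->
  (forall i j, `|z i j| <= B) -> `|z| <= B.
Proof.
move=> B0 zB; have [z0|z0] := eqVneq (mx_norm z) 0; first by rewrite /Num.norm /= z0.
by have [[i j] /= h] := mx_norm_neq0 z0; rewrite /Num.norm /= h.
Qed.

Lemma exists_common_lower (a b : C) : 0 < a -> 0 < b -> exists c, [/\ 0 < c, c <= a & c <= b].
Proof.
move=> a0 b0; have ab := addr_gt0 a0 b0; exists (a * b / (a + b)); split.
- by rewrite divr_gt0 // mulr_gt0.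
- by rewrite ler_pdivrMr // ler_pM2l // lerDr ltW.
- by rewrite ler_pdivrMr // mulrC ler_pM2l // lerDl ltW.
Qed.

End MatrixNorm.

Section MpolyInduction.
Variables (K : fieldType) (n : nat).

Lemma mpoly_alg_ind (S : {mpoly K[n]} -> Prop) :
  (forall c, S (@mpolyC n K c)) -> (forall i, S (@mpolyX n K (mnm1 i))) ->
  (forall P Q, S P -> S Q -> S (P + Q)) -> (forall P Q, S P -> S Q -> S (P * Q)) ->
  forall P, S P.
Proof.
move=> SC SX SD SM; apply: mpolyind => [|c m P _ _ SP]; first by rewrite -mpolyC0.
apply: (SD) => //; rewrite -mul_mpolyC; apply: (SM) => //; rewrite mpolyXE_id.
elim/big_ind : _ => [||i _]; [by rewrite -mpolyC1 | by move=> *; exact: SM|].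
by elim: (m i) => [|k IH]; rewrite ?expr0 -?mpolyC1 // exprS; apply: (SM).
Qed.

End MpolyInduction.

Section Polynomials.
Variables (R : realType) (n : nat).
Local Notation C := R[i].
Local Notation V := 'cV[C]_n.
Local Notation mC c := (@mpolyC n C c).
Local Notation mX i := (@mpolyX n C (mnm1 i)).
Implicit Types (P Q : {mpoly C[n]}) (v z h : V).

Lemma pevalD P Q z : peval (P + Q) z = peval P z + peval Q z.
Proof. exact: mevalD. Qed.
Lemma pevalM P Q z : peval (P * Q) z = peval P z * peval Q z.
Proof. exact: mevalM. Qed.
Lemma pevalC (c : C) z : peval (mC c) z = c.
Proof. exact: mevalC. Qed.
Lemma pevalX i z : peval (mX i) z = z i 0.
Proof. exact: mevalXU. Qed.
Lemma pevalZ (c : C) P z : peval (c *: P) z = c * peval P z.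
Proof. exact: mevalZ. Qed.
Lemma pevalB P Q z : peval (P - Q) z = peval P z - peval Q z.
Proof. exact: mevalB. Qed.
Lemma peval_sum (I : Type) (r : seq I) (p : pred I) (F : I -> {mpoly C[n]}) z :
  peval (\sum_(i <- r | p i) F i) z = \sum_(i <- r | p i) peval (F i) z.
Proof. exact: raddf_sum. Qed.

(** The bound and the Lipschitz constant are established together, since the product
    rule for the latter needs the former. *)
Lemma peval_lipschitz P (B : C) : 0 <= B -> exists2 L : C, 0 < L &
  forall z w : V, `|z| <= B -> `|w| <= B ->
    `|peval P z| <= L /\ `|peval P z - peval P w| <= L * `|z - w|.
Proof.
move=> B0; elim/mpoly_alg_ind : P => [c|i|P Q [K K0 hP] [L L0 hQ]|P Q [K K0 hP] [L L0 hQ]].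
- exists (`|c| + 1) => [|z w _ _]; first by rewrite ltr_wpDl.
  by rewrite !pevalC lerDl ler01 subrr normr0 mulr_ge0 ?addr_ge0.
- exists (B + 1) => [|z w zB wB]; first by rewrite ltr_wpDl.
  rewrite !pevalX; split.
    by apply: le_trans (mx_entry_le _ _ _) _; rewrite (le_trans zB) // lerDl.
  have := mx_entry_le (z - w) i 0; rewrite !mxE => h; apply: le_trans h _.
  by rewrite ler_peMl // lerDr.
- exists (K + L) => [|z w zB wB]; first exact: addr_gt0.
  have [h1 h2] := hP z w zB wB; have [h3 h4] := hQ z w zB wB.
  rewrite !pevalD; split; first by apply: le_trans (ler_normD _ _) _; exact: lerD.
  by rewrite opprD addrACA mulrDl; apply: le_trans (ler_normD _ _) _; exact: lerD.
- exists (2 * K * L) => [|z w zB wB]; first by rewrite !mulr_gt0.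
  have [h1 h2] := hP z w zB wB; have [h3 h4] := hQ z w zB wB.
  have [h5 _] := hP w z wB zB.
  rewrite !pevalM; split.
    rewrite normrM; apply: le_trans (ler_pM _ _ h1 h3) _ => //.
    by rewrite -mulrA ler_peMl ?mulr_ge0 ?ltW // ltr1n.
  have -> : peval P z * peval Q z - peval P w * peval Q w =
     (peval P z - peval P w) * peval Q z + peval P w * (peval Q z - peval Q w) by ring.
  apply: le_trans (ler_normD _ _) _; rewrite !normrM.
  have -> : 2 * K * L * `|z - w| = K * `|z - w| * L + K * (L * `|z - w|) by ring.
  by apply: lerD; apply: ler_pM.
Qed.

Definition line P v h : {poly C} :=
  mmap (@polyC C) (fun i => (v i 0)%:P + (h i 0) *: 'X) P.

Lemma horner_line P v h t : (line P v h).[t] = peval P (v + t *: h).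
Proof.
rewrite /line /peval mevalE /mmap horner_sum; apply: eq_bigr => m _.
rewrite hornerM hornerC; congr (_ * _); rewrite /mmap1 horner_prod.
by apply: eq_bigr => i _; rewrite horner_exp !hornerE !mxE [t * _]mulrC.
Qed.

Lemma line0 P v h : (line P v h)`_0 = peval P v.
Proof. by rewrite -horner_coef0 horner_line scale0r addr0. Qed.

(** The partial derivative, read as the linear coefficient along a coordinate line; in
    this form it is visibly linear in [P] and [cauchy_coef] applies to it. *)
Definition partial P v i : C := (line P v (delta_mx i 0))`_1.

(** The chain rule along a line: its linear coefficient is the differential of [P]. *)
Lemma line1 P v h : (line P v h)`_1 = \sum_i partial P v i * h i 0.
Proof.
rewrite /partial; elim/mpoly_alg_ind : P h => [c|i|P Q IP IQ|P Q IP IQ] h.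
- rewrite [line _ _ _]mmapC coefC /= big1 // => i _.
  by rewrite [line _ _ _]mmapC coefC /= mul0r.
- have lX g : (line (mX i) v g)`_1 = g i 0.
    by rewrite /line mmapX mmap1U coefD coefC coefZ coefX /= add0r mulr1.
  rewrite lX (bigD1 i) //= lX mxE !eqxx mul1r big1 ?addr0 // => j ji.
  by rewrite lX mxE eq_sym (negPf ji) mul0r.
- have lD g : line (P + Q) v g = line P v g + line Q v g by exact: mmapD.
  rewrite lD coefD IP IQ -big_split; apply: eq_bigr => i _.
  by rewrite lD coefD mulrDl.
- have lM g : (line (P * Q) v g)`_1 = peval P v * (line Q v g)`_1
      + peval Q v * (line P v g)`_1.
    rewrite [line _ _ _](rmorphM (mmap _ _)) -/(line P v g) -/(line Q v g).
    rewrite coefM 2!big_ord_recl big_ord0 /= !line0 addr0 [in RHS]addrC; ring.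
  rewrite lM IP IQ !mulr_sumr -big_split; apply: eq_bigr => i _.
  by rewrite lM /=; ring.
Qed.

Lemma partial_linear v i : scalar (fun P => partial P v i).
Proof.
move=> c P Q; rewrite /partial /line mmapD mmapZ coefD.
by rewrite coefCM.
Qed.

Lemma partial_bound P v (r M : C) i : 0 < r ->
  (forall w, `|w - v| <= r -> `|peval P w| <= M) -> `|partial P v i| <= M / r.
Proof.
move=> r0 PM; rewrite ler_pdivlMr // -[X in _ * X]expr1; apply: cauchy_coef => // t tr.
rewrite horner_line; apply: PM; rewrite addrAC subrr add0r.
apply: mx_norm_le => [|a b]; first exact: ltW.
by rewrite !mxE normrM tr; case: (_ && _); rewrite ?normr1 ?normr0 ?mulr1 ?mulr0 // ltW.
Qed.

Lemma geometric_bound (m : nat) (x : C) : 0 <= x -> x <= 2^-1 ->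
  \sum_(i < m) x ^+ i <= 2.
Proof.
move=> x0 x2; elim: m => [|m IH]; first by rewrite big_ord0.
rewrite big_ord_recl expr0.
under eq_bigr => i _ do rewrite /= exprS.
rewrite -mulr_sumr; apply: (@le_trans _ _ (1 + 2^-1 * 2)).
  by rewrite lerD2l ler_pM // sumr_ge0 // => i _; rewrite exprn_ge0.
by rewrite mulVf.
Qed.

(** On the complex line through [v] along h / |h| the coefficients are at most M / r^k,
    and the terms of degree at least 2 sum to a geometric series. *)
Lemma taylor1_bound P v (r M : C) h : 0 < r ->
  (forall w, `|w - v| <= r -> `|peval P w| <= M) -> `|h| <= r / 2 ->
  `|peval P (v + h) - peval P v - \sum_i partial P v i * h i 0|
    <= 2 * M / r ^+ 2 * `|h| ^+ 2.
Proof.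
move=> r0 PM hr.
have M0 : 0 <= M by apply: le_trans (PM v _); rewrite // subrr normr0 ltW.
have [->|h0] := eqVneq h 0.
  rewrite addr0 subrr sub0r normrN big1 => [|i _]; last by rewrite mxE mulr0.
  by rewrite !normr0 expr0n mulr0.
have h1 : 0 < `|h| by rewrite normr_gt0.
pose u := `|h|^-1 *: h; have hu : h = `|h| *: u.
  by rewrite /u scalerA divff ?scale1r ?gt_eqF.
have u1 : `|u| = 1 by rewrite /u normrZ normfV normr_id mulVf // gt_eqF.
pose g := line P v u; pose x := `|h| / r.
have gM k : `|g`_k| * r ^+ k <= M.
  apply: cauchy_coef => // t tr; rewrite horner_line; apply: PM.
  by rewrite addrAC subrr add0r normrZ u1 mulr1 tr.
have gk k : `|g`_k * `|h| ^+ k| <= M * x ^+ k.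
  rewrite normrM normrX normr_id /x expr_div_n mulrA mulrAC.
  by rewrite ler_wpM2r ?exprn_ge0 // ler_pdivlMr ?exprn_gt0.
have -> : peval P v = g`_0 by rewrite line0.
have -> : \sum_i partial P v i * h i 0 = g`_1 * `|h|.
  rewrite /g line1 mulr_suml; apply: eq_bigr => i _.
  by rewrite [in LHS]hu !mxE -mulrA (mulrC `|h|).
have -> : peval P (v + h) = g.[`|h|] by rewrite horner_line -hu.
have -> : g.[`|h|] - g`_0 - g`_1 * `|h| = \sum_(i < size g) g`_i.+2 * `|h| ^+ i.+2.
  have sz : (size g <= (size g).+2)%N by rewrite !leqW.
  rewrite (horner_coef_wide _ sz).
  have cancel (a b c : C) : a + (b + c) - a - b = c by ring.
  by rewrite 2!big_ord_recl /= expr0 expr1 mulr1 cancel.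
apply: le_trans (ler_norm_sum _ _ _) _.
apply: (@le_trans _ _ (\sum_(i < size g) M * x ^+ 2 * x ^+ i)).
  by apply: ler_sum => i _; rewrite -mulrA -exprD; exact: gk.
have x0 : 0 <= x by rewrite divr_ge0 // ltW.
rewrite -mulr_sumr.
have -> : 2 * M / r ^+ 2 * `|h| ^+ 2 = M * x ^+ 2 * 2.
  by rewrite /x expr_div_n; field; rewrite gt_eqF.
apply: ler_wpM2l; first by rewrite mulr_ge0 ?exprn_ge0.
apply: geometric_bound => //; rewrite /x ler_pdivrMr // mulrC.
exact: hr.
Qed.

(** Division by [D] costs only a constant and a smaller ball, uniformly in [Q], even at
    the zeros of [D]: on a suitable complex line through [z0] there is a circle on which
    |D| is bounded below, this persists on the parallel lines through nearby points, and
    the value of [Q] at the centre is bounded by its maximum on the circle. *)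
Lemma division_estimate (D : {mpoly C[n]}) w z0 (r : C) : peval D w != 0 -> 0 < r ->
  exists s d : C, [/\ 0 < s, 0 < d & forall Q (B : C),
    (forall z, `|z - z0| < r -> `|peval D z * peval Q z| <= B) ->
    forall z, `|z - z0| < s -> `|peval Q z| <= B / d].
Proof.
move=> Dw r0; pose h := w - z0; pose l := line D z0 h.
have l0 : l != 0.
  apply: contraNneq Dw => l0.
  by rewrite -(subrK z0 w) addrC -/h -[h]scale1r -horner_line -/l l0 horner0.
have hn : 0 < `|h| + 1 by rewrite ltr_wpDl.
have e0 : 0 < r / 2 / (`|h| + 1) by rewrite !divr_gt0.
have [rho [d [rho0 rhoe d0 dl]]] := circle_lower_bound l0 e0.
have rhoh : rho * `|h| <= r / 2.
  apply: (@le_trans _ _ (rho * (`|h| + 1))); first by rewrite ler_pM2l // lerDl.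
  by rewrite -ler_pdivlMr // ltW.
have B0 : 0 <= `|z0| + r by rewrite addr_ge0 // ltW.
have [L L0 hL] := peval_lipschitz D B0.
have r2 : 0 < r / 2 by rewrite divr_gt0.
have dL : 0 < d / 2 / L by rewrite !divr_gt0.
have [s [s0 s1 s2]] := exists_common_lower r2 dL.
exists s, (d / 2); split=> //; first by rewrite divr_gt0.
move=> Q B QB z zs.
have on_circle t : `|t| = rho -> `|peval Q (z + t *: h)| <= B / (d / 2).
  move=> tr; have th : `|t *: h| <= r / 2 by rewrite normrZ tr.
  have zz : `|z + t *: h - z0| < r.
    rewrite addrAC [ltRHS]splitr; apply: le_lt_trans (ler_normD _ _) _.
    by apply: ltr_leD => //; exact: lt_le_trans zs s1.
  have zB : `|z + t *: h| <= `|z0| + r.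
    rewrite -[z + _](subrK z0) addrC; apply: le_trans (ler_normD _ _) _.
    by rewrite lerD2l ltW.
  have z0B : `|z0 + t *: h| <= `|z0| + r.
    apply: le_trans (ler_normD _ _) _; rewrite lerD2l (le_trans th) //.
    by rewrite ler_pdivrMr // ler_peMr ?ltW // ltr1n.
  have [_ DL] := hL _ _ zB z0B.
  have Dlow : d / 2 <= `|peval D (z + t *: h)|.
    have h1 := dl t tr; rewrite /l horner_line in h1.
    have h2 : `|peval D (z + t *: h) - peval D (z0 + t *: h)| <= d / 2.
      apply: le_trans DL _; rewrite opprD addrACA subrr addr0 mulrC -ler_pdivlMr //.
      by rewrite ltW // (lt_le_trans zs).
    have h3 := ler_normB (peval D (z + t *: h)) (peval D (z + t *: h) - peval D (z0 + t *: h)).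
    rewrite subKr in h3; have := le_trans h1 (le_trans h3 (lerD (lexx _) h2)).
    by rewrite {1}[d]splitr lerD2r.
  rewrite ler_pdivlMr ?divr_gt0 // mulrC; apply: le_trans (QB _ zz).
  by rewrite normrM ler_wpM2r.
have := @cauchy_coef _ (line Q z h) rho _ 0 rho0.
rewrite expr0 mulr1 line0; apply => t tr; rewrite horner_line; exact: on_circle.
Qed.

End Polynomials.

(** * Differentiability from first order expansions *)

Section Differentiability.
Variables (C : numFieldType) (n m k : nat).
Local Notation V := 'cV[C]_n.
Local Notation W := 'M[C]_(m, k).

Definition combination (M : 'I_n -> W) (h : V) : W := \sum_a h a 0 *: M a.

Lemma combination_linear M : linear (combination M).
Proof.
move=> c g h; rewrite /combination scaler_sumr -big_split; apply: eq_bigr => a _.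
by rewrite !mxE scalerDl scalerA.
Qed.

HB.instance Definition _ M :=
  GRing.isLinear.Build C V W _ (combination M) (combination_linear M).

Lemma combination_continuous M : continuous (combination M : V -> W).
Proof.
apply: bounded_linear_continuous; apply/linear_boundedP.
exists (\sum_a `|M a|); split; first by rewrite realE sumr_ge0.
move=> r Mr h; apply: le_trans (ler_norm_sum _ _ _) _.
apply: (@le_trans _ _ ((\sum_a `|M a|) * `|h|)); last by rewrite ler_wpM2r // ltW.
by rewrite mulr_suml ler_sum // => a _; rewrite normrZ mulrC ler_wpM2l // mx_entry_le.
Qed.

Lemma differentiable_of_expansion (f : V -> W) (v : V) :
  (forall i j, exists (l : 'I_n -> C) (r c : C), [/\ 0 < r, 0 <= c &
     forall h : V, `|h| < r ->
       `|f (v + h) i j - f v i j - \sum_a l a * h a 0| <= c * `|h| ^+ 2]) ->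
  differentiable f v.
Proof.
move=> hf.
have /choice[l hl] (ij : 'I_m * 'I_k) := hf ij.1 ij.2.
pose M a : W := \matrix_(i, j) l (i, j) a.
have E : f = cst (f v) + (combination M \o center v) +o_v (center v : V -> V).
  apply/eqaddoP => e e0.
  have small ij : \forall h \near (0 : V), `|f (v + h) ij.1 ij.2 - f v ij.1 ij.2
       - \sum_a l ij a * h a 0| <= e * `|h|.
    have [r [c [r0 c0 hrc]]] := hl ij.
    have c1 : 0 < c + 1 by rewrite ltr_wpDl.
    have [s [s0 sr sc]] := exists_common_lower r0 (divr_gt0 e0 c1).
    apply/nbhs_norm0P; exists s => //= h hs.
    apply: le_trans (hrc h (lt_le_trans hs sr)) _; rewrite expr2 mulrA ler_wpM2r //.
    apply: (@le_trans _ _ ((c + 1) * s)).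
      by rewrite ler_pM // ?lerDl // ltW.
    by rewrite mulrC -ler_pdivlMr.
  have FF : Filter (nbhs (0 : V)) by exact: nbhs_filter.
  have all_small := filter_forall FF small.
  have : \forall h \near (0 : V), `|f (v + h) - (f v + combination M h)| <= e * `|h|.
    apply: (@filterS _ _ FF _ _ _ all_small) => h hh; apply: mx_norm_le => [|i j].
      by rewrite mulr_ge0 // ltW.
    have -> : (f (v + h) - (f v + combination M h)) i j =
        f (v + h) i j - f v i j - \sum_a l (i, j) a * h a 0.
      rewrite 3!mxE opprD addrA summxE; congr (_ - _).
      by apply: eq_bigr => a _; rewrite !mxE mulrC.
    exact: hh (i, j).
  rewrite -[X in _ -> X]near_simpl => /nbhs_norm0P[s /= s0 hs].
  apply/(@nbhs_normP C V v); exists s => //= w vw.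
  have := hs (w - v); rewrite [v + _]addrC subrK; apply.
  by rewrite /= distrC.
apply/diffP.
apply: (@getPex _ (fun (df : {linear V -> W}) => continuous df /\
  forall y, f y = f (lim (nbhs v)) + df (y - lim (nbhs v))
                  +o_(y \near v) (y - lim (nbhs v)))).
exists (combination M : {linear V -> W}); split; first exact: combination_continuous.
rewrite lim_id //.
move=> y; exact: (congr1 (fun g => g y) E).
Qed.

End Differentiability.

Section EpsilonDelta.
Variables (K : numFieldType) (V W : normedModType K).

Lemma open_ball (D : set V) z : open D -> D z ->
  exists2 r : K, 0 < r & forall w, `|w - z| < r -> D w.
Proof.
move=> oD Dz; have /nbhs_normP[r r0 hr] : nbhs z D by apply: open_nbhs_nbhs.
by exists r => // w wz; apply: hr; rewrite /= distrC.
Qed.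

Lemma differentiable_eps (f : V -> W) z (e : K) : differentiable f z -> 0 < e ->
  exists2 d : K, 0 < d & forall w, `|w - z| < d -> `|f w - f z| < e.
Proof.
move=> /differentiable_continuous /cvgrPdist_lt /(_ e) h e0.
have /nbhs_normP[d /= d0 hd] := h e0.
by exists d => // w wz; rewrite distrC; apply: hd; rewrite /= distrC.
Qed.

End EpsilonDelta.

(** * The reflection group and its action on polynomials *)

Section FiniteLower.
Variables (C : numFieldType) (I : finType).

Lemma exists_finite_lower (a : I -> C) : (forall i, 0 < a i) ->
  exists2 c, 0 < c & forall i, c <= a i.
Proof.
move=> a0; have S0 : 0 <= \sum_i (a i)^-1.
  by apply: sumr_ge0 => i _; rewrite invr_ge0 ltW.
have S1 : 0 < 1 + \sum_i (a i)^-1 by rewrite ltr_wpDr.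
exists (1 + \sum_i (a i)^-1)^-1 => [|i]; first by rewrite invr_gt0.
rewrite -[leRHS]invrK lef_pV2 ?posrE ?invr_gt0 //.
rewrite (bigD1 i) //= addrCA lerDl addr_ge0 //.
by apply: sumr_ge0 => j _; rewrite invr_ge0 ltW.
Qed.

End FiniteLower.

Section ReflectionGroup.
Variables (R : realType) (n : nat).
Local Notation C := R[i].
Variable G : {fset 'M[C]_n}.
Hypothesis hG : generated_by_pseudoreflections G.

(** The smallest matrix group containing [S] consists of invertible matrices since all
    the invertible matrices form a matrix group containing [S]. *)
Lemma generated_group : mx_group [set` G].
Proof.
have [S [SP ->]] := hG; split=> [D [[]] //|A SA|A B SA SB D hD].
  split=> [|D hD].
    apply: (SA [set B : 'M[C]_n | B \in unitmx]); split=> [|B /SP[] //]; split => /=.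
    - exact: unitmx1.
    - by move=> B uB; rewrite unitmx_inv.
    - by move=> B B' uB uB'; rewrite unitmx_mul uB.
  by have [[_ gV _] _] := hD; have [] := gV _ (SA D hD).
by have [[_ _ gM] _] := hD; apply: gM; [exact: SA | exact: SB].
Qed.

Lemma reflection_group1 : 1%:M \in G.
Proof. by have [] := generated_group. Qed.

Lemma reflection_group_unit s : s \in G -> s \in unitmx.
Proof. by move=> sG; have [_ gV _] := generated_group; have [] := gV s sG. Qed.

Lemma reflection_groupV s : s \in G -> invmx s \in G.
Proof. by move=> sG; have [_ gV _] := generated_group; have [] := gV s sG. Qed.

Lemma reflection_groupM s t : s \in G -> t \in G -> s *m t \in G.
Proof. by have [_ _ gM] := generated_group; exact: gM. Qed.

Lemma perm_mulG t : t \in G -> perm_eq [seq s *m t | s <- enum_fset G] (enum_fset G).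
Proof.
move=> tG; have ut := reflection_group_unit tG.
have inj : injective (fun s : 'M[C]_n => s *m t).
  by move=> s s' /(congr1 (fun A => A *m invmx t)); rewrite !mulmxK.
apply: uniq_perm => [||s]; rewrite ?map_inj_uniq ?fset_uniq //.
apply/mapP/idP => [[s' s'G ->]|sG]; first exact: reflection_groupM.
exists (s *m invmx t); last by rewrite mulmxKV.
by apply: reflection_groupM => //; exact: reflection_groupV.
Qed.

End ReflectionGroup.

Section Substitution.
Variables (R : realType) (n : nat).
Local Notation C := R[i].
Local Notation V := 'cV[C]_n.
Local Notation mC c := (@mpolyC n C c).
Local Notation mX i := (@mpolyX n C (mnm1 i)).
Implicit Types (P Q : {mpoly C[n]}) (v z h : V).

Lemma peval_comp (theta : n.-tuple {mpoly C[n]}) P z :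
  peval (comp_mpoly theta P) z = peval P (hsop_map theta z).
Proof.
rewrite /peval comp_mpoly_meval; apply: meval_eq => i.
by rewrite mxE.
Qed.

Definition subst (s : 'M[C]_n) P : {mpoly C[n]} :=
  comp_mpoly [tuple \sum_j s i j *: mX j | i < n] P.

Lemma peval_subst s P z : peval (subst s P) z = peval P (s *m z).
Proof.
rewrite /peval comp_mpoly_meval; apply: meval_eq => i.
rewrite tnth_mktuple -/(peval _ z) peval_sum mxE; apply: eq_bigr => j _.
by rewrite pevalZ pevalX.
Qed.

Lemma peval_prod (I : Type) (r : seq I) (p : pred I) (F : I -> {mpoly C[n]}) z :
  peval (\prod_(i <- r | p i) F i) z = \prod_(i <- r | p i) peval (F i) z.
Proof. exact: rmorph_prod. Qed.

Lemma line_neq0 P z w : peval P w != 0 -> line P z (w - z) != 0.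
Proof.
apply: contraNneq => l0.
by rewrite -(subrK z w) addrC -[w - z]scale1r -horner_line l0 horner0.
Qed.

(** Both factors restrict to nonzero polynomials on the line that joins a point where
    [P] does not vanish to one where [Q] does not. *)
Lemma nonzero_mul P Q : (exists z, peval P z != 0) -> (exists z, peval Q z != 0) ->
  exists z, peval (P * Q) z != 0.
Proof.
move=> [z Pz] [w Qw]; pose l := line P w (z - w) * line Q w (z - w).
have l0 : l != 0.
  apply: mulf_neq0; first exact: line_neq0.
  by apply: contraNneq Qw => q0; rewrite -(line0 Q w (z - w)) q0 coef0.
have [t [d [t0 _ d0 dl]]] := circle_lower_bound l0 ltr01.
exists (w + t *: (z - w)); rewrite -normr_gt0 (lt_le_trans d0) //.
have := dl t (gtr0_norm t0).
by rewrite hornerM !horner_line pevalM.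
Qed.

Lemma nonzero_prod (I : Type) (r : seq I) (p : pred I) (F : I -> {mpoly C[n]}) :
  (forall i, p i -> exists z, peval (F i) z != 0) ->
  exists z, peval (\prod_(i <- r | p i) F i) z != 0.
Proof.
move=> hF; elim/big_ind : _ => //; last exact: nonzero_mul.
by exists 0; rewrite [peval _ _]meval1 oner_neq0.
Qed.

Lemma mulmx_norm (s : 'M[C]_n) : exists2 L, 0 < L & forall z : V, `|s *m z| <= L * `|z|.
Proof.
have S0 : 0 <= \sum_i \sum_j `|s i j| by do 2!apply: sumr_ge0 => ? _.
exists (1 + \sum_i \sum_j `|s i j|) => [|z]; first by rewrite ltr_wpDr.
apply: mx_norm_le => [|i k]; first by rewrite mulr_ge0 // addr_ge0.
rewrite mxE; apply: le_trans (ler_norm_sum _ _ _) _.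
apply: (@le_trans _ _ ((\sum_j `|s i j|) * `|z|)).
  by rewrite mulr_suml ler_sum // => j _; rewrite normrM ler_wpM2l // mx_entry_le.
rewrite ler_wpM2r // [X in _ <= 1 + X](bigD1 i) //= addrCA lerDl addr_ge0 //.
by do 2!apply: sumr_ge0 => ? _.
Qed.

End Substitution.

(** * Surjectivity of theta *)

Section FreeBasis.
Variables (K : numClosedFieldType) (n d : nat).
Local Notation mC c := (@mpolyC n K c).
Local Notation mX i := (@mpolyX n K (mnm1 i)).
Variables (theta : n.-tuple {mpoly K[n]}) (p : 'I_d -> {mpoly K[n]}).
Hypothesis span : forall q, exists P : 'I_d -> {mpoly K[n]},
  q = \sum_k comp_mpoly theta (P k) * p k.
Hypothesis free : forall P : 'I_d -> {mpoly K[n]},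
  \sum_k comp_mpoly theta (P k) * p k = 0 -> forall k, P k = 0.
Implicit Types (q P : {mpoly K[n]}) (v z : 'I_n -> K).

Definition coords q : 'I_d -> {mpoly K[n]} := projT1 (cid (span q)).

Lemma coordsE q : q = \sum_k comp_mpoly theta (coords q k) * p k.
Proof. exact: projT2 (cid (span q)). Qed.

Lemma coords_eq q (P : 'I_d -> {mpoly K[n]}) :
  q = \sum_k comp_mpoly theta (P k) * p k -> coords q =1 P.
Proof.
move=> qP k; apply/eqP; rewrite -subr_eq0; apply/eqP.
apply: (free (P := fun k => coords q k - P k)).
under eq_bigr => l _ do rewrite comp_mpolyB mulrBl.
by rewrite sumrB -coordsE -qP subrr.
Qed.

Lemma coords_linear (c : K) q q' k : coords (c *: q + q') k = c *: coords q k + coords q' k.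
Proof.
apply: (coords_eq (P := fun k => c *: coords q k + coords q' k)).
under eq_bigr => l _ do rewrite comp_mpolyD comp_mpolyZ mulrDl -scalerAl.
by rewrite big_split /= -scaler_sumr -!coordsE.
Qed.

Lemma meval_coords q z : meval z q =
  \sum_k meval z (p k) * meval (fun i => meval z (tnth theta i)) (coords q k).
Proof.
rewrite {1}[q]coordsE raddf_sum /=; apply: eq_bigr => k _.
by rewrite mevalM comp_mpoly_meval mulrC.
Qed.

(** The multiplication by [q], in the basis [p], on the quotient by the ideal of the fibre
    of [theta] over [v]; vectors are rows. *)
Definition fibre_mx v q : 'M[K]_d := \matrix_(k, l) meval v (coords (q * p k) l).

Lemma coordsM q q' k l :
  coords (q * (q' * p k)) l = \sum_m coords (q' * p k) m * coords (q * p m) l.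
Proof.
apply: (coords_eq (P := fun l => \sum_m coords (q' * p k) m * coords (q * p m) l)).
rewrite {1}[q' * p k]coordsE mulr_sumr.
under eq_bigr => m _ do rewrite mulrCA {1}[q * p m]coordsE mulr_sumr.
rewrite exchange_big /=; apply: eq_bigr => i _.
rewrite raddf_sum /= mulr_suml; apply: eq_bigr => m _.
by rewrite rmorphM mulrA.
Qed.

Lemma fibre_mxM v q q' : fibre_mx v (q * q') = fibre_mx v q *m fibre_mx v q'.
Proof.
apply/matrixP => k l; rewrite mxE [q * q']mulrC -mulrA coordsM raddf_sum /= mxE.
by apply: eq_bigr => m _; rewrite mevalM !mxE.
Qed.

Lemma fibre_mxD v q q' : fibre_mx v (q + q') = fibre_mx v q + fibre_mx v q'.
Proof.
apply/matrixP => k l; rewrite !mxE mulrDl.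
have -> : q * p k + q' * p k = 1 *: (q * p k) + q' * p k by rewrite scale1r.
rewrite coords_linear scale1r.
exact: mevalD.
Qed.

Lemma fibre_mx_base v P : fibre_mx v (comp_mpoly theta P) = (meval v P)%:M.
Proof.
apply/matrixP => k l; rewrite !mxE.
rewrite (coords_eq (P := fun l => if l == k then P else 0)).
  by rewrite eq_sym; case: eqP => _; rewrite ?mulr1n // mulr0n meval0.
by rewrite (bigD1 k) //= eqxx big1 ?addr0 // => i /negPf->; rewrite comp_mpoly0 mul0r.
Qed.

(** The eigenvalues, on a common eigenvector, of the multiplications by the coordinates
    form the required point: on that eigenvector, multiplication by any [q] acts as the
    value of [q] there, and multiplication by theta_i acts as v_i. *)
Lemma theta_surjective v : (0 < d)%N -> exists z, forall i, meval z (tnth theta i) = v i.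
Proof.
move=> d0; pose As := [seq fibre_mx v (mX i) | i <- enum 'I_n].
have comm : {in As &, forall A B, comm_mx A B}.
  move=> _ _ /mapP[i _ ->] /mapP[j _ ->].
  by rewrite /comm_mx -!fibre_mxM mulrC.
have [u u0 /allP stab] := common_eigenvector d0 comm.
have /choice[z hz] (i : 'I_n) : exists a : K, u *m fibre_mx v (mX i) = a *: u.
  have /stab /sub_rVP[a ha] : fibre_mx v (mX i) \in As.
    by apply/mapP; exists i; rewrite ?mem_enum.
  by exists a.
have eig q : u *m fibre_mx v q = meval z q *: u.
  elim/mpoly_alg_ind : q => [c|i|P Q IP IQ|P Q IP IQ].
  - by rewrite -(comp_mpolyC c theta) fibre_mx_base mul_mx_scalar comp_mpolyC !mevalC.
  - by rewrite hz mevalXU.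
  - by rewrite fibre_mxD mulmxDr IP IQ mevalD scalerDl.
  - by rewrite fibre_mxM mulmxA IP -scalemxAl IQ scalerA mevalM.
exists z => i; apply/eqP; rewrite -subr_eq0.
have := eig (tnth theta i).
have {1}-> : tnth theta i = comp_mpoly theta (mX i).
  by rewrite comp_mpolyXU -tnth_nth.
rewrite fibre_mx_base mul_mx_scalar mevalXU => /eqP; rewrite eq_sym -subr_eq0 -scalerBl.
by rewrite scaler_eq0 (negPf u0) orbF.
Qed.

End FreeBasis.

(** * Openness of theta *)

Section ThetaMap.
Variables (R : realType) (n : nat).
Local Notation C := R[i].
Local Notation V := 'cV[C]_n.
Local Notation mC c := (@mpolyC n C c).
Local Notation mX i := (@mpolyX n C (mnm1 i)).
Variable G : {fset 'M[C]_n}.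
Hypothesis hG : generated_by_pseudoreflections G.
Variable theta : n.-tuple {mpoly C[n]}.
Hypothesis htheta : hsop G theta.
Local Notation th := (hsop_map theta).

Lemma theta_invariant s z : s \in G -> th (s *m z) = th z.
Proof.
by move=> sG; apply/colP => i; rewrite !mxE (hsop_invariant htheta).
Qed.

(** The polynomial in one variable whose roots at [z] are the values of [Q] on the orbit
    of [z]; its coefficients are invariant. *)
Definition orbit_poly (Q : {mpoly C[n]}) : {poly {mpoly C[n]}} :=
  \prod_(s <- enum_fset G) ('X - (subst s Q)%:P).

Lemma orbit_poly_eval Q z : map_poly (peval (R:=R) (n:=n) ^~ z) (orbit_poly Q) =
  \prod_(s <- enum_fset G) ('X - (peval Q (s *m z))%:P).
Proof.
rewrite [LHS](rmorph_prod (map_poly (meval (fun i => z i 0)))); apply: eq_bigr => s _.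
by rewrite /= map_polyXsubC -peval_subst.
Qed.

Lemma orbit_poly_coef Q z j : peval (orbit_poly Q)`_j z =
  (\prod_(s <- enum_fset G) ('X - (peval Q (s *m z))%:P))`_j.
Proof.
rewrite -orbit_poly_eval.
by rewrite [RHS](coef_map (meval (fun i => z i 0))).
Qed.

Lemma orbit_poly_invariant Q j : invariant_poly G (orbit_poly Q)`_j.
Proof.
move=> t z tG; rewrite !orbit_poly_coef; congr (nth 0 (polyseq _) j).
rewrite -[RHS](perm_big _ (perm_mulG hG tG)) big_map /=.
by apply: eq_bigr => s _; rewrite mulmxA.
Qed.

(** If |y| >= e then |y|^i <= |y|^d / e^(d - i), so that the lower terms sum to less than
    |y|^d. *)
Lemma root_bound (d : nat) (y e : C) (a : 'I_d -> C) : 0 < e ->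
  y ^+ d + \sum_i a i * y ^+ i = 0 ->
  (forall i, `|a i| <= (1 + \sum_(j < d) (e ^+ (d - j))^-1)^-1) -> `|y| < e.
Proof.
move=> e0 hy ha; rewrite real_ltNge ?normr_real ?gtr0_real //; apply/negP => ey.
have y0 : 0 < `|y| by apply: lt_le_trans ey.
set S := \sum_(j < d) _ in ha.
have S0 : 0 <= S by apply: sumr_ge0 => j _; rewrite invr_ge0 exprn_ge0 // ltW.
have S1 : 0 < 1 + S by rewrite ltr_wpDr.
have : `|y| ^+ d <= `|y| ^+ d * (S / (1 + S)).
  have yE : `|y| ^+ d = `|\sum_i a i * y ^+ i|.
    by rewrite -normrX -(normrN (\sum_i _)); congr (`|_|); apply/eqP; rewrite -addr_eq0 hy.
  rewrite {1}yE; apply: le_trans (ler_norm_sum _ _ _) _.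
  rewrite /S mulr_suml mulr_sumr; apply: ler_sum => i _.
  rewrite normrM normrX mulrA [X in _ <= X]mulrC.
  apply: ler_pM; rewrite ?exprn_ge0 ?ha //.
  rewrite ler_pdivlMr ?exprn_gt0 // -[X in _ <= _ ^+ X](subnKC (ltnW (ltn_ord i))) exprD.
  rewrite ler_pM2l ?exprn_gt0 //; apply: lerXn2r; rewrite ?nnegrE ?(ltW e0) ?(ltW y0) //.
rewrite ler_pMr ?exprn_gt0 // ler_pdivlMr // mul1r => h.
by have := lt_le_trans (ltr_pwDl ltr01 (lexx S)) h; rewrite ltxx.
Qed.

(** [Q z] is a root of the monic [orbit_poly] at [z], whose coefficients are continuous
    functions of theta z; at [z0] all its roots vanish, so the lower coefficients are 0
    there and small near it. *)
Lemma orbit_vanishing Q z0 (e : C) : 0 < e ->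
  (forall s, s \in G -> peval Q (s *m z0) = 0) ->
  exists2 delta : C, 0 < delta &
    forall z, `|th z - th z0| < delta -> `|peval Q z| < e.
Proof.
move=> e0 Q0; pose N := size (enum_fset G).
pose F z : {poly C} := \prod_(s <- enum_fset G) ('X - (peval Q (s *m z))%:P).
have Fsize z : size (F z) = N.+1 by rewrite size_prod_XsubC.
have Fmonic z : (F z)`_N = 1.
  have /monicP := monic_prod_XsubC (enum_fset G) xpredT (fun s => peval Q (s *m z)).
  by rewrite lead_coefE Fsize.
have Froot z : (F z).[peval Q z] = 0.
  rewrite horner_prod (bigD1_seq 1%:M) ?fset_uniq //=; last exact: reflection_group1.
  by rewrite mul1mx !hornerE subrr mul0r.
have Feq z : peval Q z ^+ N + \sum_(i < N) (F z)`_i * peval Q z ^+ i = 0.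
  by have := Froot z; rewrite horner_coef Fsize big_ord_recr /= Fmonic mul1r addrC.
have F0 (i : 'I_N) : (F z0)`_i = 0.
  rewrite /F (eq_big_seq (fun=> 'X)) => [|s sG]; last by rewrite Q0 // subr0.
  by rewrite big_const_seq count_predT iter_mulr_1 coefXn ltn_eqF.
have /choice[c hc] (i : 'I_N) := hsop_gen htheta (@orbit_poly_invariant Q i).
have Fc z i : (F z)`_(val i) = peval (c i) (th z).
  by rewrite -peval_comp -hc orbit_poly_coef.
pose eta : C := (1 + \sum_(j < N) (e ^+ (N - j))^-1)^-1.
have eta0 : 0 < eta.
  rewrite invr_gt0 ltr_wpDr // sumr_ge0 // => j _.
  by rewrite invr_ge0 exprn_ge0 // ltW.
have /choice[del hdel] (i : 'I_N) : exists del : C, 0 < del /\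
    forall z, `|th z - th z0| < del -> `|(F z)`_i| <= eta.
  have B0 : 0 <= `|th z0| + 1 by rewrite addr_ge0.
  have [L L0 hL] := peval_lipschitz (c i) B0.
  have [del [del0 del1 delL]] := exists_common_lower (ltr01 : 0 < (1 : C)) (divr_gt0 eta0 L0).
  exists del; split=> // z hz.
  have zB : `|th z| <= `|th z0| + 1.
    rewrite -[th z](subrK (th z0)) addrC; apply: le_trans (ler_normD _ _) _.
    by rewrite lerD2l (le_trans (ltW hz)).
  have z0B : `|th z0| <= `|th z0| + 1 by rewrite lerDl.
  have [_] := hL _ _ zB z0B; rewrite -!Fc F0 subr0 => h; apply: le_trans h _.
  by rewrite mulrC -ler_pdivlMr // (le_trans (ltW hz)).
have [delta delta0 hdelta] := exists_finite_lower (fun i => (hdel i).1).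
exists delta => // z hz; apply: root_bound e0 (Feq z) _ => i.
by apply: (hdel i).2; exact: lt_le_trans hz (hdelta i).
Qed.

(** Products over [G] of coordinate differences z_i - (s *m z0)_i, one coordinate chosen
    for each [s], vanish on the orbit of [z0].  If [z] were at distance at least [e] from
    every point of the orbit, then the choice of the largest coordinate difference for
    each [s] would give a product of modulus at least e ^+ #|G|. *)
Lemma near_orbit z0 (e : C) : 0 < e -> exists2 delta : C, 0 < delta &
  forall z, `|th z - th z0| < delta -> exists2 s, s \in G & `|z - s *m z0| < e.
Proof.
move=> e0.
pose Q (phi : {ffun G -> 'I_n}) : {mpoly C[n]} :=
  \prod_(s : G) (mX (phi s) - mC ((val s *m z0) (phi s) 0)).
have QE phi z : peval (Q phi) z = \prod_(s : G) (z (phi s) 0 - (val s *m z0) (phi s) 0).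
  rewrite peval_prod; apply: eq_bigr => s _.
  by rewrite pevalB pevalX pevalC.
have Q0 phi s : s \in G -> peval (Q phi) (s *m z0) = 0.
  by move=> sG; rewrite QE (bigD1 [` sG]%fset) //= subrr mul0r.
have /choice[del hdel] phi : exists del : C, 0 < del /\
    forall z, `|th z - th z0| < del -> `|peval (Q phi) z| < e ^+ #|{: G}|.
  have [del del0 hdel] := orbit_vanishing (exprn_gt0 #|{: G}| e0) (Q0 phi).
  by exists del.
have [delta delta0 hdelta] := exists_finite_lower (fun i => (hdel i).1).
exists delta => // z hz; apply: contrapT => far.
have /choice[f hf] (s : G) : exists i, e <= `|z i 0 - (val s *m z0) i 0|.
  have es : e <= `|z - val s *m z0|.
    have r1 : e \is Num.real by exact: gtr0_real.
    have r2 : `|z - val s *m z0| \is Num.real by exact: ger0_real.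
    rewrite real_leNgt //; apply/negP => h.
    by apply: far; exists (fsval s); rewrite ?fsvalP.
  have n0 : mx_norm (z - val s *m z0) != 0.
    by rewrite gt_eqF //; exact: lt_le_trans e0 es.
  have [[i j] /= hij] := mx_norm_neq0 n0; exists i.
  move: es; rewrite {1}/Num.norm /= hij !mxE; have -> : j = 0 by rewrite ord1.
  by [].
have := (hdel (finfun f)).2 z (lt_le_trans hz (hdelta (finfun f))).
rewrite QE normr_prod => h.
have : e ^+ #|{: G}| <= \prod_(s : G) `|z (finfun f s) 0 - (val s *m z0) (finfun f s) 0|.
  rewrite -prodr_const; apply: ler_prod => s _.
  by rewrite ltW //= ffunE hf.
by move=> h'; have := lt_le_trans h h'; rewrite ltxx.
Qed.

Section Openness.
Variables (d : nat) (p : 'I_d -> {mpoly C[n]}).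
Hypotheses (d0 : (0 < d)%N) (hp : invariant_basis G p).

Lemma invariant_basis_theta_span q : exists P : 'I_d -> {mpoly C[n]},
  q = \sum_k comp_mpoly theta (P k) * p k.
Proof.
have [c [ci ->]] := invariant_basis_span hp q.
have /choice[P hP] k := hsop_gen htheta (ci k).
by exists P; apply: eq_bigr => k _; rewrite hP.
Qed.

Lemma invariant_basis_theta_free (P : 'I_d -> {mpoly C[n]}) :
  \sum_k comp_mpoly theta (P k) * p k = 0 -> forall k, P k = 0.
Proof.
move=> P0 k; apply: (hsop_algindep htheta).
apply: (@invariant_basis_free _ _ _ _ _ hp (fun k => comp_mpoly theta (P k))) => //.
by move=> l s z sG; rewrite !peval_comp theta_invariant.
Qed.

(** A preimage of [v] is close to some s *m z0, and invmx s moves it close to [z0]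
    without changing its image. *)
Lemma theta_open z0 (e : C) : 0 < e -> exists2 delta : C, 0 < delta &
  forall v, `|v - th z0| < delta -> exists2 z, `|z - z0| < e & th z = v.
Proof.
move=> e0; have /choice[L hL] (s : G) : exists L : C, 0 < L /\
    forall z : V, `|invmx (val s) *m z| <= L * `|z|.
  by have [L L0 hL] := mulmx_norm (invmx (val s)); exists L.
have [e' e'0 he'] := exists_finite_lower (fun s : G => divr_gt0 e0 (hL s).1).
have [delta delta0 hdelta] := near_orbit z0 e'0.
exists delta => // v hv.
have [w hw] := theta_surjective invariant_basis_theta_span invariant_basis_theta_free
  (fun i => v i 0) d0.
pose z : V := \col_i w i.
have zv : th z = v.
  apply/colP => i; rewrite mxE -hw /peval; apply: meval_eq => j; by rewrite mxE.
have [s sG zs] : exists2 s, s \in G & `|z - s *m z0| < e' by apply: hdelta; rewrite zv.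
exists (invmx s *m z); last by rewrite theta_invariant // reflection_groupV.
have -> : invmx s *m z - z0 = invmx s *m (z - s *m z0).
  by rewrite mulmxBr mulKmx // (reflection_group_unit hG).
have [L0 Ls] := hL [` sG]%fset; apply: le_lt_trans (Ls _) _.
have := he' [` sG]%fset; rewrite ler_pdivlMr // => h; apply: lt_le_trans h.
by rewrite mulrC ltr_pM2r.
Qed.

End Openness.

End ThetaMap.

(** * Bounds for the components of a polynomial *)

Section EvalMatrix.
Variables (K : comNzRingType) (n d : nat) (v : 'I_n -> K).

Lemma meval_det (M : 'M[{mpoly K[n]}]_d) : meval v (\det M) = \det (map_mx (meval v) M).
Proof. exact: (esym (det_map_mx (meval v) M)). Qed.

Lemma meval_adj (M : 'M[{mpoly K[n]}]_d) i j :
  meval v (\adj M i j) = \adj (map_mx (meval v) M) i j.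
Proof. by rewrite -(map_mx_adj (meval v)) [RHS]mxE. Qed.

End EvalMatrix.

Section Components.
Variables (R : realType) (n : nat).
Local Notation C := R[i].
Local Notation V := 'cV[C]_n.
Local Notation mC c := (@mpolyC n C c).
Local Notation mX i := (@mpolyX n C (mnm1 i)).
Variable G : {fset 'M[C]_n}.
Hypothesis hG : generated_by_pseudoreflections G.
Variable theta : n.-tuple {mpoly C[n]}.
Hypothesis htheta : hsop G theta.
Local Notation th := (hsop_map theta).
Local Notation d := #|` G|.
Variable p : 'I_d -> {mpoly C[n]}.
Hypothesis hp : invariant_basis G p.
Local Notation co := (coords (invariant_basis_theta_span htheta hp)).

Lemma peval_coords q z : peval q z = \sum_k peval (p k) z * peval (co q k) (th z).
Proof.
rewrite {1}/peval (meval_coords (invariant_basis_theta_span htheta hp)).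
apply: eq_bigr => k _; congr (_ * _); apply: meval_eq => i.
by rewrite mxE.
Qed.

(** For s <> t the points fixed by s^-1 t lie in the zero set of a nonzero linear form,
    and a finite product of nonzero polynomials does not vanish identically. *)
Lemma free_orbit : exists z0 : V, forall s t, s \in G -> t \in G ->
  s *m z0 = t *m z0 -> s = t.
Proof.
pose F (st : G * G) (i : 'I_n) : {mpoly C[n]} :=
  \sum_j (val st.1 i j - val st.2 i j) *: mX j.
have Fe st i z : peval (F st i) z = (val st.1 *m z) i 0 - (val st.2 *m z) i 0.
  rewrite peval_sum !mxE -sumrB; apply: eq_bigr => j _.
  by rewrite pevalZ pevalX mulrBl.
have /choice[f hf] (st : G * G) : exists Q, (st.1 != st.2 -> exists z, peval Q z != 0) /\
    (forall z, val st.1 *m z = val st.2 *m z -> peval Q z = 0).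
  have [->|st12] := eqVneq st.1 st.2; first by exists 0; split=> // z _; exact: meval0.
  have /matrix0Pn[i [j ij]] : val st.1 - val st.2 != 0 by rewrite subr_eq0 val_eqE.
  exists (F st i); split=> [_|z eqz]; last by rewrite Fe eqz subrr.
  exists (delta_mx j 0); rewrite Fe -!colE.
  by move: ij; rewrite !mxE.
have [|z0 hz0] := @nonzero_prod R n _ (index_enum _) (fun st : G * G => st.1 != st.2) f.
  by move=> st /(hf st).1.
exists z0 => s t sG tG eqst; apply/eqP; apply: contraNT hz0 => st.
rewrite peval_prod (bigD1 ([` sG]%fset, [` tG]%fset)) //=.
by rewrite (hf ([` sG]%fset, [` tG]%fset)).2 // mul0r.
Qed.

Definition element (s : 'I_d) : 'M[C]_n := tnth (in_tuple (enum_fset G)) s.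

Lemma element_in s : element s \in G.
Proof. exact: mem_tnth. Qed.

Lemma element_inj : injective element.
Proof. by apply/tuple_uniqP; exact: fset_uniq. Qed.

Definition orbit_mx (z : V) : 'M[C]_d := \matrix_(s, k) peval (p k) (element s *m z).

Definition orbit_mpoly_mx : 'M[{mpoly C[n]}]_d := \matrix_(s, k) subst (element s) (p k).

Lemma orbit_mxE z : orbit_mx z = map_mx (meval (fun i => z i 0)) orbit_mpoly_mx.
Proof. by apply/matrixP => s k; rewrite !mxE -peval_subst. Qed.

(** On a free orbit every function is interpolated by a polynomial, and the components of
    the interpolating polynomials are the columns of a right inverse of the orbit
    matrix. *)
Lemma det_orbit_mx_neq0 : exists z, \det (orbit_mx z) != 0.
Proof.
have [z0 hz0] := free_orbit; exists z0.
pose x s := element s *m z0.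
have /choice[q hq] (st : 'I_d * 'I_d) : exists q, st.1 != st.2 ->
    peval q (x st.1) = 1 /\ peval q (x st.2) = 0.
  have [e|st12] := eqVneq st.1 st.2; first by exists 0.
  have /cV0Pn[i xi] : x st.1 - x st.2 != 0.
    rewrite subr_eq0; apply: contraNneq st12 => e; apply/eqP/element_inj.
    by apply: hz0 e; exact: element_in.
  have eB (a b : V) : (a - b) i 0 = a i 0 - b i 0 by rewrite !mxE.
  rewrite eB in xi.
  exists ((x st.1 i 0 - x st.2 i 0)^-1 *: (mX i - mC (x st.2 i 0))) => _.
  by rewrite !pevalZ !pevalB !pevalX !pevalC subrr mulr0 mulVf.
(* Lagrange interpolation at the points of the orbit. *)
pose l s : {mpoly C[n]} := \prod_(t | t != s) q (s, t).
have lE s t : peval (l s) (x t) = (t == s)%:R.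
  rewrite peval_prod; have [->|ts] := eqVneq t s.
    by rewrite big1 // => u us; rewrite (hq (s, u) _).1 //= eq_sym.
  by rewrite (bigD1 t) //= (hq (s, t) _).2 ?mul0r //= eq_sym.
pose B : 'M[C]_d := \matrix_(k, s) peval (co (l s) k) (th z0).
have AB : orbit_mx z0 *m B = 1%:M.
  apply/matrixP => t s; rewrite !mxE -lE peval_coords; apply: eq_bigr => k _.
  by rewrite !mxE (theta_invariant htheta) // element_in.
apply/negP => /eqP D0; have := det_mulmx (orbit_mx z0) B.
by rewrite AB det1 D0 mul0r => /eqP; rewrite oner_eq0.
Qed.

(** The components are constant on the orbit of [z], so that the decompositions of [q] at
    its points form a linear system with matrix [orbit_mx z]. *)
Lemma component_cramer q k z : \det (orbit_mx z) * peval (co q k) (th z) =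
  \sum_s \adj (orbit_mx z) k s * peval q (element s *m z).
Proof.
pose c : 'cV[C]_d := \col_k peval (co q k) (th z).
have Ac : orbit_mx z *m c = \col_s peval q (element s *m z).
  apply/colP => s; rewrite !mxE peval_coords; apply: eq_bigr => l _.
  by rewrite !mxE (theta_invariant htheta) // element_in.
have := congr1 (mulmx (\adj (orbit_mx z))) Ac.
rewrite mulmxA mul_adj_mx mul_scalar_mx => /colP/(_ k); rewrite !mxE => ->.
by apply: eq_bigr => s _; rewrite !mxE.
Qed.

(** [N] stands for the norm of [H] on polynomials.  Bounds for [q] near the points of the
    orbit of [z0] bound det * P_k by [component_cramer]; [division_estimate] then removes
    the determinant and [theta_open] carries the result to a neighbourhood of theta z0. *)
Lemma component_bound (N : {mpoly C[n]} -> C) z0 : (forall q, 0 <= N q) ->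
  (forall s, s \in G -> exists r M : C, [/\ 0 < r, 0 <= M & forall q z,
     `|z - s *m z0| < r -> `|peval q z| <= M * N q]) ->
  exists r M : C, [/\ 0 < r, 0 <= M & forall q k v,
     `|v - th z0| < r -> `|peval (co q k) v| <= M * N q].
Proof.
move=> N0 hN.
have /choice[rM hrM] (s : 'I_d) : exists rM : C * C, [/\ 0 < rM.1, 0 <= rM.2 &
    forall q z, `|z - z0| < rM.1 -> `|peval q (element s *m z)| <= rM.2 * N q].
  have [r [M [r0 M0 h]]] := hN _ (element_in s).
  have [L L0 hL] := mulmx_norm (element s).
  exists (r / L, M); split=> //=; first by rewrite divr_gt0.
  move=> q z hz; apply: h; rewrite -mulmxBr; apply: le_lt_trans (hL _) _.
  by rewrite mulrC -ltr_pdivlMr.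
have rM0 s : 0 < (rM s).1 by have [] := hrM s.
have [r1 r10 hr1] := exists_finite_lower rM0.
have [r [r0 rr1 rle1]] := exists_common_lower r10 (ltr01 : 0 < (1 : C)).
have B0 : 0 <= `|z0| + 1 by rewrite addr_ge0.
have /choice[L hL] (ks : 'I_d * 'I_d) : exists L : C, 0 < L /\ forall z : V,
    `|z| <= `|z0| + 1 -> `|\adj (orbit_mx z) ks.1 ks.2| <= L.
  have [L L0 hL] := peval_lipschitz (\adj orbit_mpoly_mx ks.1 ks.2) B0.
  exists L; split=> // z zB; have [h _] := hL z z zB zB.
  by move: h; rewrite /peval meval_adj -orbit_mxE.
have [w hw] := det_orbit_mx_neq0.
have DE z : peval (\det orbit_mpoly_mx) z = \det (orbit_mx z).
  by rewrite orbit_mxE -meval_det.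
rewrite -DE in hw.
have [e [del [e0 del0 hdiv]]] := division_estimate z0 hw r0.
have d0 : (0 < d)%N by rewrite cardfs_gt0; apply/fset0Pn; exists 1%:M; exact: reflection_group1.
have [r' r'0 hr'] := theta_open hG htheta d0 hp z0 e0.
pose A k := \sum_s L (k, s) * (rM s).2.
have A0 k : 0 <= A k.
  by apply: sumr_ge0 => s _; rewrite mulr_ge0 // ?(ltW (hL _).1) //; have [] := hrM s.
exists r', (\sum_k A k / del); split=> //.
  by apply: sumr_ge0 => k _; rewrite divr_ge0 // ltW.
move=> q k v /hr'[z zz0 <-].
apply: (@le_trans _ _ (A k * N q / del)); last first.
  rewrite mulrAC ler_wpM2r // (bigD1 k) //= lerDl.
  by apply: sumr_ge0 => j _; rewrite divr_ge0 // ltW.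
rewrite -peval_comp; apply: hdiv zz0 => z' hz'.
rewrite DE peval_comp component_cramer mulr_suml.
apply: le_trans (ler_norm_sum _ _ _) _; apply: ler_sum => s _.
have zB : `|z'| <= `|z0| + 1.
  rewrite -[z'](subrK z0) addrC; apply: le_trans (ler_normD _ _) _.
  by rewrite lerD2l (le_trans (ltW hz')).
rewrite normrM -mulrA; apply: ler_pM => //; first exact: (hL (k, s)).2.
have [_ _ h] := hrM s; apply: h; apply: lt_le_trans hz' _.
exact: le_trans rr1 (hr1 s).
Qed.

End Components.

(** * Analytic Hilbert modules *)

Section AnalyticModule.
Variables (R : realType) (n : nat).
Local Notation C := R[i].
Local Notation V := 'cV[C]_n.
Variable Omega : set V.
Hypothesis dOmega : domain Omega.
Variables (H : set (V -> C^o)) (ip : (V -> C^o) -> (V -> C^o) -> C) (K : V -> V -> C^o).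
Hypothesis hH : analytic_hilbert_module Omega H ip K.
Local Notation N := (ip_norm ip).
Local Notation iota := (poly_fun Omega).
Let hilb := ahm_hilbert hH.

(** Otherwise there would be points z_j -> w with unbounded kernel functions, although
    f(z_j) -> f(w) for every [f] in [H], against [uniform_boundedness]. *)
Lemma evaluation_bound w : Omega w -> exists r M : C, [/\ 0 < r, 0 <= M &
  forall z, `|z - w| < r -> Omega z /\ forall f, H f -> `|f z| <= M * N f].
Proof.
move=> Ow; have [_ oOmega _] := dOmega; have [r0 r00 hr0] := open_ball oOmega Ow.
suff [r [M [r1 M0 hM]]] : exists r M : C, [/\ 0 < r, 0 <= M &
    forall z, `|z - w| < r -> Omega z /\ N (K ^~ z) <= M].
  exists r, M; split=> // z /hM[Oz KM]; split=> // f hf.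
  have [hK <-] := ahm_kernel hH Oz; last exact: hf.
  apply: le_trans (cauchy_schwarz hilb hf hK) _.
  by rewrite mulrC ler_wpM2r // (ip_norm_ge0 hilb).
apply: contrapT => unb.
(* The radii stay below [r0], inside [Omega], and tend to 0. *)
pose r (j : nat) : C := r0 / j.+1%:R.
have rj0 j : 0 < r j by rewrite divr_gt0.
have rjr j : r j <= r0 by rewrite ler_pdivrMr // ler_peMr ?ler1n // ltW.
have /choice[z hz] (j : nat) : exists z, `|z - w| < r j /\ ~ (N (K ^~ z) <= j%:R).
  apply: contrapT => nz; apply: unb; exists (r j), j%:R; split=> // z zw.
  have Oz : Omega z by apply: hr0; exact: lt_le_trans zw (rjr j).
  by split=> //; apply: contrapT => nN; apply: nz; exists z.
have Oz j : Omega (z j) by apply: hr0; exact: lt_le_trans (hz j).1 (rjr j).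
have HK j : H (K ^~ (z j)) by have [] := ahm_kernel hH (Oz j).
have [B hB] : exists B : C, forall j, N (K ^~ (z j)) <= B.
  apply: (uniform_boundedness hilb HK) => f hf.
  have [d d0 hd] := differentiable_eps ((ahm_holo hH hf).1 w Ow) (ltr01 : 0 < (1 : C)).
  have [J hJ] := invS_eventually_lt (divr_gt0 d0 r00).
  exists (`|f w| + 1 + \sum_(j < J) `|f (z j)|) => j.
  have -> : ip f (K ^~ (z j)) = f (z j) by have [_ ->] := ahm_kernel hH (Oz j).
  have S0 : 0 <= \sum_(j < J) `|f (z j)| by apply: sumr_ge0.
  have [jJ|Jj] := ltnP j J.
    rewrite (bigD1 (Ordinal jJ)) //= addrCA lerDl !addr_ge0 //.
    exact: sumr_ge0.
  have zd : `|z j - w| < d.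
    apply: lt_le_trans (hz j).1 _; rewrite /r mulrC -ler_pdivlMr // ltW //.
    exact: hJ.
  apply: (@le_trans _ _ (`|f w| + 1)); last by rewrite lerDl.
  rewrite -[f (z j)](subrK (f w)) addrC; apply: le_trans (ler_normD _ _) _.
  by rewrite lerD2l ltW // hd.
have B0 : 0 <= B by exact: le_trans (ip_norm_ge0 hilb (HK 0%N)) (hB 0%N).
have [j hj] := natr_unbounded B0.
by apply: (hz j).2; exact: le_trans (hB j) hj.
Qed.

Lemma poly_funE q z : Omega z -> iota q z = peval q z.
Proof. by move=> Oz; rewrite /poly_fun patchE mem_set. Qed.

Lemma poly_fun_linear : linear iota.
Proof.
move=> c q q'; apply/funext => z; rewrite !fctE /poly_fun !patchE.
case: ifP => _; last by rewrite scaler0 addr0.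
by rewrite pevalD pevalZ.
Qed.

Lemma poly_bound w : Omega w -> exists r M : C, [/\ 0 < r, 0 <= M &
  forall q z, `|z - w| < r -> `|peval q z| <= M * N (iota q)].
Proof.
move=> Ow; have [r [M [r0 M0 hM]]] := evaluation_bound Ow.
exists r, M; split=> // q z /hM[Oz hz].
by rewrite -poly_funE //; apply: hz; exact: ahm_poly hH q.
Qed.

Lemma poly_riesz (phi : {mpoly C[n]} -> C^o) (M : C) : scalar phi -> 0 <= M ->
  (forall q, `|phi q| <= M * N (iota q)) ->
  exists2 kappa, H kappa & forall q, phi q = ip (iota q) kappa.
Proof.
move=> phiL M0 phiM.
exact: (riesz hilb poly_fun_linear (ahm_poly hH) phiL M0 phiM).
Qed.

Lemma poly_dense kappa (c : C) : H kappa -> 0 <= c ->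
  (forall q, `|ip (iota q) kappa| <= c * N (iota q)) ->
  forall f, H f -> `|ip f kappa| <= c * N f.
Proof.
move=> hk c0; apply: (weak_dense_bound hilb (ahm_poly hH)) => //.
exact: ahm_dense hH.
Qed.

End AnalyticModule.

(** * The image of Gamma *)

Section GammaImage.
Variables (R : realType) (n : nat).
Local Notation C := R[i].
Local Notation V := 'cV[C]_n.
Variable G : {fset 'M[C]_n}.
Hypothesis hG : generated_by_pseudoreflections G.
Variable Omega : set V.
Hypotheses (dOmega : domain Omega) (GOmega : invariant_set G Omega).
Variable theta : n.-tuple {mpoly C[n]}.
Hypothesis htheta : hsop G theta.
Local Notation th := (hsop_map theta).
Local Notation d := #|` G|.
Variable p : 'I_d -> {mpoly C[n]}.
Hypothesis hp : invariant_basis G p.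
Variables (H : set (V -> C^o)) (ip : (V -> C^o) -> (V -> C^o) -> C) (K : V -> V -> C^o).
Hypothesis hH : analytic_hilbert_module Omega H ip K.
Local Notation N := (ip_norm ip).
Local Notation iota := (poly_fun Omega).
Local Notation co := (coords (invariant_basis_theta_span htheta hp)).
Local Notation D := (th @` Omega).
Let hilb := ahm_hilbert hH.

Lemma group_order_gt0 : (0 < d)%N.
Proof. by rewrite cardfs_gt0; apply/fset0Pn; exists 1%:M; exact: reflection_group1 hG. Qed.

Lemma omega_stable s z : s \in G -> Omega z -> Omega (s *m z).
Proof. by move=> sG Oz; rewrite -(GOmega sG); exists z. Qed.

Lemma co_linear k v : scalar (fun q => peval (co q k) v : C^o).
Proof.
move=> c q q'.
by rewrite (coords_linear _ (invariant_basis_theta_free htheta hp)) pevalD pevalZ.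
Qed.

Lemma local_bound v0 : D v0 -> exists r M : C, [/\ 0 < r, 0 <= M &
  forall v, `|v - v0| < r -> D v /\
    forall q k, `|peval (co q k) v| <= M * N (iota q)].
Proof.
move=> [z0 Oz0 <-].
have Nge q : 0 <= N (iota q) := ip_norm_ge0 hilb (ahm_poly hH q).
have [r [M [r0 M0 hM]]] := component_bound hG htheta hp (N := fun q => N (iota q)) Nge
  (fun s sG => poly_bound dOmega hH (omega_stable sG Oz0)).
have [_ oOmega _] := dOmega; have [e e0 he] := open_ball oOmega Oz0.
have [r' r'0 hr'] := theta_open hG htheta group_order_gt0 hp z0 e0.
have [s [s0 sr sr']] := exists_common_lower r0 r'0.
exists s, M; split=> // v hv; split; last first.
  by move=> q k; apply: hM; exact: lt_le_trans hv sr.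
have [z zz0 <-] := hr' v (lt_le_trans hv sr').
by exists z => //; exact: he.
Qed.

Lemma component_riesz (vk : V * 'I_d) : exists kappa, D vk.1 ->
  H kappa /\ forall q, peval (co q vk.2) vk.1 = ip (iota q) kappa.
Proof.
have [Dv|nD] := pselect (D vk.1); last by exists 0.
have [r [M [r0 M0 hM]]] := local_bound Dv.
have [_ hv] : D vk.1 /\ forall q k, `|peval (co q k) vk.1| <= M * N (iota q).
  by apply: hM; rewrite subrr normr0.
have [kappa hk hq] := poly_riesz hH (co_linear vk.2 vk.1) M0 (fun q => hv q vk.2).
by exists kappa.
Qed.

(** The element of [H] that represents, on polynomials, the value at [v] of the k-th
    component. *)
Definition component_kernel v k : V -> C^o := projT1 (cid (component_riesz (v, k))).

Lemma component_kernel_in v k : D v -> H (component_kernel v k).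
Proof. by move=> Dv; have [] := projT2 (cid (component_riesz (v, k))) Dv. Qed.

Lemma component_kernelE v k q : D v -> peval (co q k) v = ip (iota q) (component_kernel v k).
Proof. by move=> Dv; have [_] := projT2 (cid (component_riesz (v, k))) Dv; apply. Qed.

(** The explicit formula for [Gamma f], see [GammaE]. *)
Definition components (f : V -> C^o) : V -> 'cV[C]_d :=
  fun v => if v \in D then \col_k ip f (component_kernel v k) else 0.

Lemma componentsE f v k : D v -> components f v k 0 = ip f (component_kernel v k).
Proof. by move=> Dv; rewrite /components mem_set // mxE. Qed.

Lemma components_out f v : ~ D v -> components f v = 0.
Proof. by move=> nD; rewrite /components memNset. Qed.

(** First order expansion of the components, uniform over [H].  For fixed [h] the left
    side is a single represented functional, so [poly_dense] reduces the estimate to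
    polynomials, where it is [taylor1_bound]. *)
Lemma components_expansion v0 k : D v0 -> exists r c : C, exists lam : 'I_n -> V -> C^o,
  [/\ 0 < r, 0 <= c, forall a, H (lam a) & forall h, `|h| < r -> D (v0 + h) /\
    forall f, H f -> `|ip f (component_kernel (v0 + h) k) - ip f (component_kernel v0 k)
      - \sum_a ip f (lam a) * h a 0|
      <= c * N f * `|h| ^+ 2].
Proof.
move=> Dv0; have [r [M [r0 M0 hM]]] := local_bound Dv0.
(* Cauchy estimates need a bound on a closed ball, hence the smaller radius r / 2. *)
have r2 : 0 < r / 2 by rewrite divr_gt0.
have r2r : r / 2 < r by rewrite ltr_pdivrMr // ltr_pMr // ltr1n.
have bound q w : `|w - v0| <= r / 2 -> `|peval (co q k) w| <= M * N (iota q).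
  by move=> hw; apply: (hM w (le_lt_trans hw r2r)).2.
have /choice[lam hlam] (a : 'I_n) : exists lam, H lam /\
    forall q, partial (co q k) v0 a = ip (iota q) lam.
  have phiL : scalar (fun q => partial (co q k) v0 a : C^o).
    move=> c q q'; rewrite (coords_linear _ (invariant_basis_theta_free htheta hp)).
    exact: partial_linear.
  have M2 : 0 <= M / (r / 2) by rewrite divr_ge0 // ltW.
  have phiM q : `|partial (co q k) v0 a| <= M / (r / 2) * N (iota q).
    by rewrite mulrAC; apply: partial_bound r2 (bound q).
  by have [kappa hk hq] := poly_riesz hH phiL M2 phiM; exists kappa.
have hlamH a : H (lam a) by have [] := hlam a.
have c0 : 0 <= 2 * M / (r / 2) ^+ 2 by rewrite divr_ge0 ?mulr_ge0 ?exprn_ge0 // ltW.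
exists (r / 2 / 2), (2 * M / (r / 2) ^+ 2), lam; split=> //.
  by rewrite !divr_gt0.
move=> h hh.
have Dh : D (v0 + h).
  apply: (hM (v0 + h) _).1; rewrite addrAC subrr add0r.
  apply: lt_trans hh _; apply: lt_trans r2r.
  by rewrite ltr_pdivrMr // ltr_pMr // ltr1n.
split=> // f hf.
have [h1 h2] := (component_kernel_in k Dh, component_kernel_in k Dv0).
have hl a : H (Num.conj (h a 0) *: lam a) by apply: hilbertZ hilb _ _ _.
have hs : H (\sum_a Num.conj (h a 0) *: lam a) by apply: hilbert_sum hilb _ _ _ _ _.
pose kappa := component_kernel (v0 + h) k - component_kernel v0 k
  - \sum_a Num.conj (h a 0) *: lam a.
have hB := hilbertB hilb h1 h2; have hk : H kappa := hilbertB hilb hB hs.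
have E g : H g -> ip g kappa =
    ip g (component_kernel (v0 + h) k) - ip g (component_kernel v0 k) - \sum_a ip g (lam a) * h a 0.
  move=> hg; rewrite (ipBr hilb) // (ipBr hilb) // (ip_sumr hilb) //; congr (_ - _).
  by apply: eq_bigr => a _; rewrite (ipZr hilb) // conjCK mulrC.
rewrite -E // mulrAC; apply: (poly_dense hH) => //.
  by rewrite mulr_ge0 // exprn_ge0.
move=> q; rewrite E; last exact: ahm_poly hH q.
rewrite -!component_kernelE //.
under eq_bigr => a _ do rewrite -(hlam a).2.
rewrite mulrAC.
have -> : 2 * M / (r / 2) ^+ 2 * N (iota q) = 2 * (M * N (iota q)) / (r / 2) ^+ 2.
  by rewrite [in RHS]mulrA mulrAC.
by apply: taylor1_bound r2 (bound q) (ltW hh).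
Qed.

Lemma holo_of_components m l (F : V -> 'M[C]_(m, l)) :
  (forall i j, exists f k, H f /\ forall v, D v -> F v i j = components f v k 0) ->
  (forall v, ~ D v -> F v = 0) -> @holo R V 'M[C]_(m, l) D F.
Proof.
move=> hF F0; split=> // v Dv; apply: differentiable_of_expansion => i j.
have [f [k [hf Fk]]] := hF i j.
have [r [c [lam [r0 c0 hlam hr]]]] := components_expansion k Dv.
exists (fun a => ip f (lam a)), r, (c * N f); split=> //.
  by rewrite mulr_ge0 // (ip_norm_ge0 hilb).
move=> h hh; have [Dh hf'] := hr h hh.
by rewrite !Fk // !componentsE //; exact: hf'.
Qed.

Lemma components_holo f : H f -> @holo R V 'cV[C]_d D (components f).
Proof.
move=> hf; apply: holo_of_components => [i j|v]; last exact: components_out.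
by exists f, i; split=> // v _; rewrite [j]ord1.
Qed.

(** For fixed [z] the decomposition states that two represented functionals agree, which
    it suffices to check on polynomials. *)
Lemma components_decomposition f : H f -> decomposition Omega theta p f (components f).
Proof.
move=> hf; split=> [|z Oz]; first exact: components_holo.
have Dz : D (th z) by exists z.
have [hK KE] := ahm_kernel hH Oz.
have hk k := component_kernel_in k Dz.
have hl k : H (Num.conj (peval (p k) z) *: component_kernel (th z) k) by apply: hilbertZ hilb _ _ _.
have hs : H (\sum_k Num.conj (peval (p k) z) *: component_kernel (th z) k).
  by apply: hilbert_sum hilb _ _ _ _ _.
pose kappa := K ^~ z - \sum_k Num.conj (peval (p k) z) *: component_kernel (th z) k.
have hkappa : H kappa := hilbertB hilb hK hs.
have E g : H g -> ip g kappa = g z - \sum_k peval (p k) z * ip g (component_kernel (th z) k).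
  move=> hg; rewrite (ipBr hilb) // KE // (ip_sumr hilb) //; congr (_ - _).
  by apply: eq_bigr => a _; rewrite (ipZr hilb) // conjCK.
have : `|ip f kappa| <= 0 * N f.
  apply: (poly_dense hH) => // q; rewrite E; last exact: ahm_poly hH q.
  rewrite poly_funE // {1}(peval_coords htheta hp).
  under eq_bigr => k _ do rewrite component_kernelE //.
  by rewrite subrr normr0 mul0r.
rewrite mul0r normr_le0 E // subr_eq0 => /eqP ->.
by apply: eq_bigr => k _; rewrite componentsE.
Qed.

Lemma theta_lipschitz (B : C) : 0 <= B -> exists2 L : C, 0 < L &
  forall z w : V, `|z| <= B -> `|w| <= B -> `|th z - th w| <= L * `|z - w|.
Proof.
move=> B0; have /choice[L hL] (i : 'I_n) : exists L : C, 0 < L /\ forall z w : V,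
    `|z| <= B -> `|w| <= B ->
    `|peval (tnth theta i) z - peval (tnth theta i) w| <= L * `|z - w|.
  have [L L0 hL] := peval_lipschitz (tnth theta i) B0.
  by exists L; split=> // z w zB wB; have [] := hL z w zB wB.
have S0 : 0 <= \sum_i L i by apply: sumr_ge0 => i _; rewrite ltW // (hL i).1.
exists (1 + \sum_i L i) => [|z w zB wB]; first by rewrite ltr_wpDr.
apply: mx_norm_le => [|i j]; first by rewrite mulr_ge0 // addr_ge0.
rewrite !mxE; apply: le_trans ((hL i).2 z w zB wB) _; rewrite ler_wpM2r //.
rewrite (bigD1 i) //= addrCA lerDl addr_ge0 // sumr_ge0 // => a _.
by rewrite ltW // (hL a).1.
Qed.

(** The determinant of the orbit matrix has isolated zeros on a line towards a point where
    it does not vanish. *)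
Lemma generic_dense z0 (e : C) : Omega z0 -> 0 < e ->
  exists z, [/\ Omega z, `|z - z0| < e & \det (orbit_mx p z) != 0].
Proof.
move=> Oz0 e0; have [_ oOmega _] := dOmega; have [r r0 hr] := open_ball oOmega Oz0.
have [w hw] := det_orbit_mx_neq0 htheta hp.
have DE z : peval (\det (orbit_mpoly_mx p)) z = \det (orbit_mx p z).
  by rewrite orbit_mxE -meval_det.
rewrite -DE in hw; have l0 := line_neq0 z0 hw.
have [s [s0 sr se]] := exists_common_lower r0 e0.
have h1 : 0 < `|w - z0| + 1 by rewrite ltr_wpDl.
have [t [del [t0 ts del0 hdel]]] := circle_lower_bound l0 (divr_gt0 s0 h1).
have close : `|z0 + t *: (w - z0) - z0| < s.
  rewrite addrAC subrr add0r normrZ gtr0_norm //.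
  apply: (@le_lt_trans _ _ (t * (`|w - z0| + 1))); first by rewrite ler_pM2l // lerDl.
  by rewrite -ltr_pdivlMr.
exists (z0 + t *: (w - z0)); split.
- by apply: hr; exact: lt_le_trans close sr.
- exact: lt_le_trans close se.
- rewrite -DE -horner_line -normr_gt0; apply: lt_le_trans del0 _.
  by apply: hdel; rewrite gtr0_norm.
Qed.

(** Two decompositions agree at theta w for every generic [w], and generic points are
    dense while both decompositions are continuous. *)
Lemma decomposition_unique f F1 F2 : decomposition Omega theta p f F1 ->
  decomposition Omega theta p f F2 -> F1 = F2.
Proof.
move=> [[F1d F1o] hF1] [[F2d F2o] hF2]; apply/funext => v.
have [[z Oz <-{v}]|nD] := pselect (D v); last by rewrite F1o // F2o.
have Dz : D (th z) by exists z.
apply/eqP; rewrite -subr_eq0 -normr_eq0; apply: contrapT => ne.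
have e0 : 0 < `|F1 (th z) - F2 (th z)| / 2.
  by rewrite divr_gt0 // lt_def normr_ge0 andbT; apply/negP.
have [d1 d10 hd1] := differentiable_eps (F1d _ Dz) e0.
have [d2 d20 hd2] := differentiable_eps (F2d _ Dz) e0.
have [d3 [d30 d31 d32]] := exists_common_lower d10 d20.
have B0 : 0 <= `|z| + 1 by rewrite addr_ge0.
have [L L0 hL] := theta_lipschitz B0.
have [s [s0 s1 sd]] := exists_common_lower (ltr01 : 0 < (1 : C)) (divr_gt0 d30 L0).
have [w [Ow wz detw]] := generic_dense Oz s0.
have thw : `|th w - th z| < d3.
  have wB : `|w| <= `|z| + 1.
    rewrite -[w](subrK z) addrC; apply: le_trans (ler_normD _ _) _.
    by rewrite lerD2l (le_trans (ltW wz)).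
  have zB : `|z| <= `|z| + 1 by rewrite lerDl.
  apply: le_lt_trans (hL _ _ wB zB) _.
  by rewrite mulrC -ltr_pdivlMr // (lt_le_trans wz).
have F12 : F1 (th w) = F2 (th w).
  have uA : orbit_mx p w \in unitmx by rewrite unitmxE unitfE.
  apply: (can_inj (mulKmx uA)); apply/colP => s'.
  have Os := omega_stable (element_in s') Ow.
  have := hF1 _ Os; rewrite (hF2 _ Os) (theta_invariant htheta) ?element_in // => E.
  have rhs F : (orbit_mx p w *m F (th w)) s' 0 =
      \sum_k peval (p k) (element s' *m w) * F (th w) k 0.
    by rewrite mxE; apply: eq_bigr => k _; rewrite mxE.
  by rewrite !rhs.
have h1 := hd1 _ (lt_le_trans thw d31); have h2 := hd2 _ (lt_le_trans thw d32).
have := ltrD h1 h2; rewrite -splitr F12 distrC => h.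
have := le_lt_trans (ler_normD _ _) h; rewrite addrA subrK.
by rewrite ltxx.
Qed.

Lemma GammaE f : H f -> Gamma Omega theta p f = components f.
Proof.
move=> hf; have dec := components_decomposition hf.
rewrite /Gamma; case: xgetP => [F _ dF|/(_ _ dec) //].
exact: decomposition_unique dF dec.
Qed.

Lemma components_linear (c : C) f g : H f -> H g ->
  components (c *: f + g) = c *: components f + components g.
Proof.
move=> hf hg; apply/funext => v; rewrite !fctE.
have [Dv|nD] := pselect (D v); last by rewrite !components_out // scaler0 addr0.
apply/colP => k; rewrite !mxE !componentsE //.
by rewrite (hilbert_ipP hilb) //; exact: component_kernel_in.
Qed.

Lemma components_inj f g : H f -> H g -> components f = components g -> f = g.
Proof.
move=> hf hg fg; apply/funext => z; have [Oz|nO] := pselect (Omega z).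
  have [_ ->] := components_decomposition hf => //.
  have [_ ->] := components_decomposition hg => //.
  by rewrite fg.
by rewrite (ahm_holo hH hf).2 // (ahm_holo hH hg).2.
Qed.

Local Notation tH := (tildeH Omega theta p H).
Local Notation tip := (tilde_ip Omega theta p H ip).

Lemma tildeHP F : tH F <-> exists2 f, H f & F = components f.
Proof.
split=> [[f hf <-]|[f hf ->]]; first by exists f => //; rewrite GammaE.
by exists f => //; rewrite GammaE.
Qed.

Lemma Gamma_invE f : H f -> Gamma_inv Omega theta p H (components f) = f.
Proof.
move=> hf; rewrite /Gamma_inv; case: xgetP => [g _ [hg gf]|/(_ f)[]]; last first.
  by split=> //; rewrite GammaE.
by apply: components_inj => //; rewrite -GammaE.
Qed.

Lemma tilde_ipE f g : H f -> H g -> tip (components f) (components g) = ip f g.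
Proof. by move=> hf hg; rewrite /tilde_ip !Gamma_invE. Qed.

Lemma componentsB f g : H f -> H g -> components (f - g) = components f - components g.
Proof.
move=> hf hg; rewrite addrC -scaleN1r components_linear //.
by rewrite scaleN1r addrC.
Qed.

Lemma components0 : components 0 = 0.
Proof.
have h0 := hilbert0 hilb.
by rewrite -(subrr (0 : V -> C^o)) componentsB // subrr.
Qed.

Lemma tilde_norm f : H f -> ip_norm tip (components f) = N f.
Proof. by move=> hf; rewrite /ip_norm tilde_ipE. Qed.

Lemma tildeH_hilbert : hilbert_space tH tip.
Proof.
split.
- by apply/tildeHP; exists 0; [exact: hilbert0 hilb | rewrite components0].
- move=> a _ _ /tildeHP[f hf ->] /tildeHP[g hg ->]; apply/tildeHP.
  by exists (a *: f + g); [exact: hilbertP hilb _ _ _ hf hg | rewrite components_linear].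
- move=> a _ _ _ /tildeHP[f hf ->] /tildeHP[g hg ->] /tildeHP[h hh ->].
  rewrite -components_linear // !tilde_ipE //; first exact: hilbert_ipP hilb _ _ _ _ hf hg hh.
  exact: hilbertP hilb _ _ _ hf hg.
- move=> _ _ /tildeHP[f hf ->] /tildeHP[g hg ->]; rewrite !tilde_ipE //.
  exact (hilbert_ipC hilb hf hg).
- by move=> _ /tildeHP[f hf ->]; rewrite tilde_ipE //; exact (hilbert_ip_ge0 hilb hf).
- move=> _ /tildeHP[f hf ->]; rewrite tilde_ipE // => /(hilbert_ip_eq0 hilb hf) ->.
  exact: components0.
- move=> u /(fun h k => (tildeHP (u k)).1 (h k)) hu cauchy.
  have /choice[f hf] k : exists f, H f /\ u k = components f.
    by have [f hf uf] := hu k; exists f.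
  have Hf k : H (f k) by have [] := hf k.
  have uB g k : H g -> ip_norm tip (u k - components g) = N (f k - g).
    move=> hg; rewrite (hf k).2 -componentsB // tilde_norm //.
    exact (hilbertB hilb (Hf k) hg).
  have [e e0|g hg lim] := hilbert_complete hilb Hf.
    have [m hm] := cauchy e e0; exists m => k l mk ml.
    by have := hm k l mk ml; rewrite {1}(hf l).2 uB.
  exists (components g); first by apply/tildeHP; exists g.
  move=> e e0; have [m hm] := lim e e0; exists m => k mk.
  by rewrite uB // hm.
Qed.

(** The reproducing kernel; pairing with its k-th column has to give the k-th component at
    [v]. *)
Definition tilde_kernel (u v : V) : 'M[C]_d :=
  \matrix_(l, k) (if v \in D then components (component_kernel v k) u l 0 else 0).

(** Hermitian symmetry: conjugation exchanges the two points and the two indices, which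
    turns antiholomorphy in [v] into holomorphy of components. *)
Lemma tilde_kernelE u v : map_mx Num.conj (tilde_kernel u v) =
  \matrix_(l, k) (if u \in D then components (component_kernel u l) v k 0 else 0).
Proof.
apply/matrixP => l k; rewrite !mxE.
have [Dv|nv] := pselect (D v); have [Du|nu] := pselect (D u).
- rewrite !mem_set // !componentsE //.
  by rewrite -(hilbert_ipC hilb (component_kernel_in k Dv) (component_kernel_in l Du)).
- by rewrite mem_set // memNset // components_out // mxE rmorph0.
- by rewrite memNset // mem_set // components_out // mxE rmorph0.
- by rewrite !memNset // rmorph0.
Qed.

Lemma tilde_kernel_section v x : D v ->
  (fun u => tilde_kernel u v *m x) = components (\sum_k x k 0 *: component_kernel v k).
Proof.
move=> Dv; have hk k : H (component_kernel v k) := component_kernel_in k Dv.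
have hZ k : H (x k 0 *: component_kernel v k) by apply: hilbertZ hilb _ _ _.
have hs : H (\sum_k x k 0 *: component_kernel v k) by apply: hilbert_sum hilb _ _ _ _ _.
apply/funext => u; apply/colP => l; rewrite mxE.
have [Du|nu] := pselect (D u); last first.
  rewrite components_out // mxE big1 // => k _.
  by rewrite mxE mem_set // components_out // mxE mul0r.
rewrite componentsE // (ip_suml hilb) //; last exact: component_kernel_in.
apply: eq_bigr => k _; rewrite mxE mem_set // componentsE //.
by rewrite [LHS]mulrC (ipZl hilb) //; exact: component_kernel_in.
Qed.

Lemma tilde_kernel_reproducing : vreproducing_kernel D tH tip tilde_kernel.
Proof.
split.
- move=> v Dv; apply: holo_of_components => [l k|u nu].
    by exists (component_kernel v k), l; split=> [|u _];
      [exact: component_kernel_in | rewrite mxE mem_set].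
  by apply/matrixP => l k; rewrite !mxE mem_set // components_out // mxE.
- move=> u Du; under eq_fun => v do rewrite tilde_kernelE.
  apply: holo_of_components => [l k|v nv].
    by exists (component_kernel u l), k; split=> [|v _];
      [exact: component_kernel_in | rewrite mxE mem_set].
  by apply/matrixP => l k; rewrite !mxE mem_set // components_out // mxE.
- move=> v x Dv; rewrite tilde_kernel_section //; apply/tildeHP.
  exists (\sum_k x k 0 *: component_kernel v k) => //.
  by apply: hilbert_sum hilb _ _ _ _ _ => k _;
    apply: hilbertZ hilb _ _ _; exact: component_kernel_in.
- move=> _ v x /tildeHP[f hf ->] Dv; rewrite tilde_kernel_section //.
  have hZ k : H (x k 0 *: component_kernel v k) by
    apply: hilbertZ hilb _ _ _; exact: component_kernel_in.
  rewrite tilde_ipE //; last by apply: hilbert_sum hilb _ _ _ _ _.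
  rewrite (ip_sumr hilb) // /cdot; apply: eq_bigr => k _.
  by rewrite componentsE // [RHS]mulrC; apply: (ipZr hilb) => //; exact: component_kernel_in.
Qed.

Lemma tildeH_vrkhs : vrkhs D tH tip.
Proof.
split; first exact: tildeH_hilbert.
- by move=> _ /tildeHP[f hf ->]; exact: components_holo.
- by exists tilde_kernel; exact: tilde_kernel_reproducing.
Qed.

End GammaImage.

Theorem lemma6p1 (R : realType) (n : nat)
    (G : {fset 'M[R[i]]_n}) (hG : generated_by_pseudoreflections G)
    (Omega : set 'cV[R[i]]_n)
    (hOmega : domain Omega) (bOmega : bounded_set Omega)
    (GOmega : invariant_set G Omega)
    (theta : n.-tuple {mpoly R[i][n]}) (htheta : hsop G theta)
    (p : 'I_(#|` G|) -> {mpoly R[i][n]}) (hp : invariant_basis G p)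
    (H : set ('cV[R[i]]_n -> R[i]^o))
    (ip : ('cV[R[i]]_n -> R[i]^o) -> ('cV[R[i]]_n -> R[i]^o) -> R[i])
    (K : 'cV[R[i]]_n -> 'cV[R[i]]_n -> R[i]^o)
    (hH : analytic_hilbert_module Omega H ip K)
    (GK : invariant_kernel G Omega K) :
  vrkhs (hsop_map theta @` Omega)
    (tildeH Omega theta p H) (tilde_ip Omega theta p H ip).
Proof. exact: (tildeH_vrkhs hG hOmega GOmega htheta hp hH). Qed.
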